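(* Let $\Phi:(E,Q_E\equiv\{l_k\}_{k\ge1})\to(F,Q_F\equiv\{m_k\}_{k\ge1})$ be a Lie $\infty$-isomorphism between Lie $\infty$-algebras of finite dimension. Then the modular class of $\Phi$ vanishes, i.e. the class of $\omega_\Phi:=\omega_E-\Phi^*(\omega_F)$ in $H^1(E,Q_E)$ is zero.
   Context: Graded vector spaces are $\mathbb Z$-graded over $\mathbb K=\mathbb R$ or $\mathbb C$, of finite total dimension; $|x|$ is the degree of $x$, and $(E^* )_i=(E_{-i})^*$. $S(E)$ is the graded symmetric algebra with product $\odot$ ($x\odot y=(-1)^{|x||y|}y\odot x$). The Koszul sign $\epsilon(\sigma)$ is defined by $x_{\sigma(1)}\odot\cdots\odot x_{\sigma(n)}=\epsilon(\sigma)\,x_1\odot\cdots\odot x_n$, and $Sh(i,n-i)$ is the set of $\sigma\in S_n$ with $\sigma(1)<\dots<\sigma(i)$ and $\sigma(i+1)<\dots<\sigma(n)$. A (symmetric) Lie $\infty$-algebra structure on $E$ is a family of degree $+1$ linear maps $l_k:S^k(E)\to E$, $k\ge1$, with $$\sum_{i+j=n+1}\sum_{\sigma\in Sh(i,j-1)}\epsilon(\sigma)\,l_j(l_i(x_{\sigma(1)},\dots,x_{\sigma(i)}),x_{\sigma(i+1)},\dots,x_{\sigma(n)})=0$$ for all $n\ge 1$ and homogeneous $x_1,\dots,x_n\in E$. Identify $S^k(E^* )$ with $(S^kE)^*$ via $(f_1\odot\cdots\odot f_k)(x_1\odot\cdots\odot x_k)=\sum_{\sigma\in S_k}\epsilon(\sigma)(f_1\otimes\cdots\otimes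 f_k)(x_{\sigma(1)}\otimes\cdots\otimes x_{\sigma(k)})$, with the Koszul rule $(f\otimes g)(x\otimes y)=(-1)^{|x||g|}f(x)g(y)$ (iterated). The algebra of functions $\mathcal E$ consists of formal sums $F=\sum_{k\ge1}F^{(k)}$ with $F^{(k)}\in S^k(E^* )$ (arity $k$); $\mathcal E_n$ denotes functions of degree $n$. The derivation $Q_E:\mathcal E\to\mathcal E$ of degree $+1$, squaring to zero, is $Q_E=\sum_{k\ge0}Q_E^{(k)}$ with $Q_E^{(k)}(\xi)(x_1\odot\cdots\odot x_{k+1})=(-1)^{|\xi|}\langle\xi,l_{k+1}(x_1,\dots,x_{k+1})\rangle$ for $\xi\in E^*$. $H^\bullet(E,Q_E)$ is the cohomology of $(\mathcal E,Q_E)$. A Lie $\infty$-morphism $\Phi:E\to F$ is a family of degree $0$ linear maps $\Phi_k:S^k(E)\to F$, $k\ge1$, such that the graded algebra morphism $\Phi^*:\mathcal F\to\mathcal E$ (with $\mathcal F$ the functions on $F$) extending the dual maps $\Phi_k^*:F^*\to S^k(E^* )$ satisfies $\Phi^*\circ Q_F=Q_E\circ\Phi^*$. It is a Lie $\infty$-isomorphism if it is invertible as a Lie $\infty$-morphism; equivalently $\Phi_1:(E,l_1)\to(F,m_1)$ is an isomorphism of complexes. Modular function of $E$: $\omega_E=\sum_{k\ge1}\omega^{(k)}\in\mathcal E_{+1}$, where for homogeneous $x_1,\dots,x_k\in E$ whose degrees add up to $-1$, $\omega^{(k)}(x_1,\dots,x_k)=\mathrm{Str}\big(l_{k+1}(x_1,\dots,x_k,-)\big)$,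 with $\mathrm{Str}(\phi)=\sum_i(-1)^i\mathrm{tr}(\phi|_{E_i})$. It is $Q_E$-closed, and so $\omega_\Phi$ is $Q_E$-closed. *)

(* Defs.v *)
From HB Require Import structures.
From mathcomp Require Import all_boot all_order all_algebra all_fingroup.
From mathcomp Require Import reals.
From mathcomp Require Import complex.

Set Implicit Arguments.
Unset Strict Implicit.
Unset Printing Implicit Defensive.

Import GRing.Theory.
Local Open Scope ring_scope.

Variant base_field := RealNumbers | ComplexNumbers.

Definition scalars (R : realType) (b : base_field) : fieldType :=
  match b with
  | RealNumbers => R
  | ComplexNumbers => R[i]
  end.

(* [gdegs] lists finitely many degrees outside of which the components vanish. *)
Record gradedSpace (K : fieldType) := GradedSpace {
  gcarrier :> vectType K;
  gpart : int -> {vspace gcarrier};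
  gdegs : seq int;
  gpart_eq0 : forall i, i \notin gdegs -> gpart i = 0%VS;
  gpart_total :
    {: gcarrier}%VS = (\sum_(i : seq_sub gdegs) gpart (val i))%VS;
  gpart_direct : directv (\sum_(i : seq_sub gdegs) gpart (val i))
}.

Definition gproj (K : fieldType) (E : gradedSpace K) (i : seq_sub (gdegs E)) :
  'End(E) := sumv_pi_for (gpart_total E) i.

Definition homog (K : fieldType) (E : gradedSpace K) (d : seq int) (x : seq E)
  : bool := all2 (fun i v => v \in gpart E i) d x.

Definition sumz (d : seq int) : int := \sum_(i <- d) i.

(* A family of linear maps [S^k(E) -> V], [k >= 1], is one function on finite
   sequences, its restriction to sequences of length [k] being the [k]-th map;
   the value at the empty sequence is irrelevant and set to [0].  The last
   clause is the defining relation of [S(E)]. *)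
Definition sym_family (K : fieldType) (E : gradedSpace K) (V : lmodType K)
    (f : seq E -> V) : Prop :=
  [/\ f [::] = 0,
      forall (s t : seq E) (a : K) (x y : E),
        f (s ++ (a *: x + y) :: t) = a *: f (s ++ x :: t) + f (s ++ y :: t)
    & forall (s t : seq E) (i j : int) (x y : E),
        x \in gpart E i -> y \in gpart E j ->
        f (s ++ x :: y :: t) = (-1) ^ (i * j) *: f (s ++ y :: x :: t)].

Definition family_degree (K : fieldType) (E F : gradedSpace K) (p : int)
    (f : seq E -> F) : Prop :=
  forall (d : seq int) (x : seq E), x != [::] -> homog d x ->
    f x \in gpart F (sumz d + p).

Definition shuffle (n i : nat) (s : 'S_n) : bool :=
  [forall a : 'I_n, forall b : 'I_n,
     ((a < b)%N && ((b < i)%N || (i <= a)%N)) ==> (s a < s b)%N].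

(* The sequence [x_{s(1)}, ..., x_{s(n)}]. *)
Definition permseq (T : Type) (x0 : T) (n : nat) (s : 'S_n) (x : seq T) :
  seq T := [seq nth x0 x (s a) | a <- enum 'I_n].

(* One factor [(-1)^(|x||y|)] for each pair that [s] puts in reverse order. *)
Definition koszul (K : fieldType) (n : nat) (s : 'S_n) (d : seq int) : K :=
  \prod_(p : 'I_n * 'I_n | (p.1 < p.2)%N && (s p.2 < s p.1)%N)
     (-1) ^ (nth 0 d (s p.1) * nth 0 d (s p.2)).

Definition jacobi (K : fieldType) (E : gradedSpace K) (l : seq E -> E) : Prop :=
  forall (d : seq int) (x : seq E), homog d x ->
    \sum_(1 <= i < (size x).+1) \sum_(s : 'S_(size x) | shuffle i s)
      koszul K s d *:
        l (l (take i (permseq 0 s x)) :: drop i (permseq 0 s x)) = 0.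

Record lieInfty (K : fieldType) := LieInfty {
  lspace :> gradedSpace K;
  lbr : seq lspace -> lspace;
  lbr_sym : sym_family lbr;
  lbr_degree : family_degree 1 lbr;
  lbr_jacobi : jacobi lbr
}.

(* Through [S^k(E^* ) = (S^k E)^* ], a formal sum [F = sum_(k >= 1) F^(k)] is a
   family of linear forms on the [S^k(E)]. *)
Definition is_function (K : fieldType) (E : gradedSpace K) (f : seq E -> K) :
  Prop := sym_family (V := K^o) f.

(* The degree is [n] when [f] only pairs with total degree [-n], as
   [(E^* )_n = (E_{-n})^*]. *)
Definition function_degree (K : fieldType) (E : gradedSpace K) (n : int)
    (f : seq E -> K) : Prop :=
  forall (d : seq int) (x : seq E), homog d x -> f x != 0 -> sumz d = - n.

Definition has_arity (K : fieldType) (E : gradedSpace K) (k : nat)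
    (f : seq E -> K) : Prop :=
  forall x : seq E, size x != k -> f x = 0.

(* The product of [S(E^* )] read on [S(E)], at homogeneous arguments:
   [(f . g)(x_1 ... x_n)] is the sum, over shuffles, of
   [eps(s) (f (x) g)(x_{s(1)} ... x_{s(i)} (x) x_{s(i+1)} ... x_{s(n)})].
   The Koszul rule for [f (x) g] gives [(-1)^(|x'||g|)], and [g] contributes at
   [x''] only through its component of degree [-|x''|].  Iterating from arity 1
   gives the sum over all of [S_k] of the usual pairing. *)
Definition fmul_homog (K : fieldType) (E : gradedSpace K) (f g : seq E -> K)
    (d : seq int) (x : seq E) : K :=
  \sum_(i < (size x).+1) \sum_(s : 'S_(size x) | shuffle i s)
    koszul K s d *
    (-1) ^ (sumz (take i (permseq 0 s d)) * sumz (drop i (permseq 0 s d))) *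
    (f (take i (permseq 0 s x)) * g (drop i (permseq 0 s x))).

(* Multilinear extension to arbitrary arguments, by splitting each of them into
   homogeneous components. *)
Definition fmul (K : fieldType) (E : gradedSpace K) (f g : seq E -> K)
    (x : seq E) : K :=
  \sum_(d : (size x).-tuple (seq_sub (gdegs E)))
    fmul_homog f g (map val d) [seq gproj iv.1 iv.2 | iv <- zip d x].

(* Linear operators that never lower the arity, i.e. that are sums
   [sum_(k >= 0) D^(k)] with [D^(k)] raising the arity by [k]. *)
Definition function_operator (K : fieldType) (E F : gradedSpace K) (p : int)
    (D : (seq E -> K) -> (seq F -> K)) : Prop :=
  [/\ forall f, is_function f -> is_function (D f),
      forall (a : K) f g, is_function f -> is_function g ->
        forall x, D (fun y => a * f y + g y) x = a * D f x + D g x,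
      forall (n : int) f, is_function f -> function_degree n f ->
        function_degree (n + p) (D f)
    & forall (N : nat) f g, is_function f -> is_function g ->
        (forall y, (size y <= N)%N -> f y = g y) ->
        forall x, (size x <= N)%N -> D f x = D g x].

Definition derivation (K : fieldType) (E : gradedSpace K) (p : int)
    (D : (seq E -> K) -> (seq E -> K)) : Prop :=
  function_operator p D /\
  forall (n : int) f g, is_function f -> function_degree n f ->
    is_function g -> forall x,
    D (fmul f g) x = fmul (D f) g x + (-1) ^ (p * n) * fmul f (D g) x.

Definition algebra_morphism (K : fieldType) (E F : gradedSpace K)
    (P : (seq F -> K) -> (seq E -> K)) : Prop :=
  function_operator 0 P /\
  forall f g, is_function f -> is_function g ->
    forall x, P (fmul f g) x = fmul (P f) (P g) x.

(* [Q] is the derivation [Q_E]; it is determined by its values on [E^*]. *)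
Definition is_QE (K : fieldType) (E : lieInfty K)
    (Q : (seq E -> K) -> (seq E -> K)) : Prop :=
  derivation 1 Q /\
  forall (n : int) xi, is_function xi -> has_arity 1 xi ->
    function_degree n xi ->
    forall x, x != [::] -> Q xi x = (-1) ^ n * xi [:: lbr x].

(* [P] is the algebra morphism [Phi^*] extending the dual maps of [Phi]. *)
Definition is_pullback (K : fieldType) (E F : gradedSpace K) (Phi : seq E -> F)
    (P : (seq F -> K) -> (seq E -> K)) : Prop :=
  algebra_morphism P /\
  forall xi, is_function xi -> has_arity 1 xi ->
    forall x, x != [::] -> P xi x = xi [:: Phi x].

Definition lie_morphism (K : fieldType) (E F : lieInfty K)
    (QE : (seq E -> K) -> (seq E -> K)) (QF : (seq F -> K) -> (seq F -> K))
    (Phi : seq E -> F) (P : (seq F -> K) -> (seq E -> K)) : Prop :=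
  [/\ sym_family Phi, family_degree 0 Phi, is_pullback Phi P
    & forall f, is_function f -> forall x, P (QF f) x = QE (P f) x].

(* Invertibility: there is a morphism [Psi] such that [Psi o Phi] and
   [Phi o Psi] are identities, the composite of morphisms being the one whose
   pullback is the composite of the pullbacks. *)
Definition lie_isomorphism (K : fieldType) (E F : lieInfty K)
    (QE : (seq E -> K) -> (seq E -> K)) (QF : (seq F -> K) -> (seq F -> K))
    (Phi : seq E -> F) (P : (seq F -> K) -> (seq E -> K)) : Prop :=
  lie_morphism QE QF Phi P /\
  exists (Psi : seq F -> E) (P' : (seq E -> K) -> (seq F -> K)),
    [/\ lie_morphism QF QE Psi P',
        forall f, is_function f -> forall x, P (P' f) x = f x
      & forall f, is_function f -> forall x, P' (P f) x = f x].

(* [tr(phi|_{E_i})] is computed in a basis of [E_i]; the projection makes the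
   trace zero when [phi] has nonzero degree. *)
Definition supertrace (K : fieldType) (E : gradedSpace K) (phi : E -> E) : K :=
  \sum_(i : seq_sub (gdegs E)) (-1) ^ (val i) *
    \sum_(j < \dim (gpart E (val i)))
      coord (vbasis (gpart E (val i))) j
        (gproj i (phi (vbasis (gpart E (val i)))`_j)).

(* No condition on degrees is needed: unless those of [x] add up to [-1],
   [l(x, -)] has nonzero degree and its supertrace vanishes. *)
Definition modular_function (K : fieldType) (E : lieInfty K) (x : seq E) : K :=
  if x is [::] then 0 else supertrace (fun v => lbr (rcons x v)).

(* The class in [H^n(E, Q)] of the cocycle [w] is zero. *)
Definition class_zero (K : fieldType) (E : gradedSpace K)
    (Q : (seq E -> K) -> (seq E -> K)) (n : int) (w : seq E -> K) : Prop :=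
  exists g : seq E -> K,
    [/\ is_function g, function_degree (n - 1) g & forall x, w x = Q g x].

Definition relative_modular_function (K : fieldType) (E F : lieInfty K)
    (P : (seq F -> K) -> (seq E -> K)) (x : seq E) : K :=
  modular_function x - P (@modular_function K F) x.

(* Main.v *)
(** Think of [E] as a formal graded manifold with coordinates dual to a
homogeneous basis, and of [Q_E] as a vector field.  Then [omega_E] is the
divergence [tr L] of [Q_E], where [L_ab = d_a (Q_E x_b)].  Let [J] be the Jacobian
matrix of [Phi] and [M] the pullback of the Jacobian matrix of [Q_F].
Differentiating [Phi^* Q_F = Q_E Phi^*] gives [J M = L J + Q_E J], up to signs, so
that [Phi^* omega_F = tr M = tr L + tr (J^-1 Q_E J)], and [tr (J^-1 Q_E J)] is
[Q_E] applied to the logarithm of the Berezinian of [J], normalised by its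
constant part.

The inverse of [J] is the pullback of the Jacobian matrix of the inverse of
[Phi].  An even matrix [A] has the supertrace [sum_a (-1)^|a| A_aa], an odd one the
ordinary trace; then [tr (A B) = tr (B A)] for [A] even and [B] odd, and
[A |-> ((-1)^|a| Q A_ab)] is a derivation without signs on even matrices. *)

(* The statement gives [QE], [QF] and the pullbacks only as operators on functions without constant
   term, multiplied by shuffle sums. A Jacobian, however, has a constant part, the linear part of
   [Phi], and inverting it needs a unital ring. Hence the passage to power series in coordinates,
   where the shuffle product is a Leibniz recursion on words and the ring laws are inductions on one
   letter.

   Since the operators are not given by formulas, the chain rules rest on uniqueness: by Euler's
   formula, an operator compatible with the arity filtration is controlled by its behaviour on
   coordinates. This and the coefficients of the logarithm are where characteristic zero enters.

   No Berezinian is constructed. With [J0] the constant part of [J] and [N = J J0^-1 - 1], the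
   series [Str (log (1 + N))] suffices: [N] vanishes at the origin, so the series is a finite sum in
   each arity, and [Q] respects the arity filtration, so it acts term by term. The series has no
   constant term, which makes it a function in the sense of the statement. *)
From HB Require Import structures.
Require Import Defs.
From mathcomp Require Import all_boot all_order all_algebra reals.
From mathcomp Require Import all_fingroup boolp complex ring.

Set Implicit Arguments.
Unset Strict Implicit.
Unset Printing Implicit Defensive.

Import GRing.Theory.
Local Open Scope ring_scope.

(** * Functions on words and their shuffle product *)

(* Words list the arguments of a multilinear map backwards, so that [wder] is the
   contraction with the last argument.  It is a left derivation of the product of
   [S(E^* )], and this Leibniz rule is taken as the definition of [wmul]. *)
Section Words.
Variables (K : fieldType) (T : Type) (p : T -> bool).
Implicit Types (f g h : seq T -> K) (w : seq T) (t : T) (q : bool) (c : K).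

Definition wpar w : bool := foldr (fun t b => p t (+) b) false w.
Definition wder t f : seq T -> K := fun w => f (t :: w).
(** The sign [(-1)^(q|f|)] of the Leibniz rule, for inhomogeneous [f] as well: each word is signed
    by its own parity. *)
Definition wsgn q f : seq T -> K := fun w => (-1) ^+ (q && wpar w) * f w.

Fixpoint wmul f g w : K :=
  if w is t :: w' then wmul (wder t f) g w' + wmul (wsgn (p t) f) (wder t g) w'
  else f [::] * g [::].

Definition wcst c : seq T -> K := fun w => if w is [::] then c else 0.

Lemma wder_mul t f g :
  wder t (wmul f g) = wmul (wder t f) g \+ wmul (wsgn (p t) f) (wder t g).
Proof. by []. Qed.

Lemma wmulDl f f' g : wmul (f \+ f') g = wmul f g \+ wmul f' g.
Proof.
apply: funext => w; elim: w f f' g => [|t w IH] f f' g /=; first by rewrite mulrDl.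
have -> : wder t (f \+ f') = wder t f \+ wder t f' by [].
have -> : wsgn (p t) (f \+ f') = wsgn (p t) f \+ wsgn (p t) f'.
  by apply: funext => v; rewrite /wsgn /= mulrDr.
by rewrite !IH /= addrACA.
Qed.

Lemma wmulDr f g g' : wmul f (g \+ g') = wmul f g \+ wmul f g'.
Proof.
apply: funext => w; elim: w f g g' => [|t w IH] f g g' /=; first by rewrite mulrDr.
have -> : wder t (g \+ g') = wder t g \+ wder t g' by [].
by rewrite !IH /= addrACA.
Qed.

Lemma wmulZl c f g : wmul (c \*o f) g = c \*o wmul f g.
Proof.
apply: funext => w; elim: w f g => [|t w IH] f g /=; first by rewrite mulrA.
have -> : wder t (c \*o f) = c \*o wder t f by [].
have -> : wsgn (p t) (c \*o f) = c \*o wsgn (p t) f.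
  by apply: funext => v; rewrite /wsgn /= mulrCA.
by rewrite !IH /= mulrDr.
Qed.

Lemma wmulZr c f g : wmul f (c \*o g) = c \*o wmul f g.
Proof.
apply: funext => w; elim: w f g => [|t w IH] f g /=; first by rewrite mulrCA.
have -> : wder t (c \*o g) = c \*o wder t g by [].
by rewrite !IH /= mulrDr.
Qed.

Lemma wder_sgn q t f : wder t (wsgn q f) = (-1) ^+ (q && p t) \*o wsgn q (wder t f).
Proof.
apply: funext => w; rewrite /wder /wsgn /= mulrA -signr_addb; congr (_ ^+ _ * _).
by case: q; rewrite ?addbF.
Qed.

Lemma wsgnC q q' f : wsgn q (wsgn q' f) = wsgn q' (wsgn q f).
Proof. by apply: funext => w; rewrite /wsgn mulrCA. Qed.

Lemma wsgnD q f g : wsgn q (f \+ g) = wsgn q f \+ wsgn q g.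
Proof. by apply: funext => w; rewrite /wsgn /= mulrDr. Qed.

Lemma wsgn_mul q f g : wsgn q (wmul f g) = wmul (wsgn q f) (wsgn q g).
Proof.
apply: funext => w; elim: w f g => [|t w IH] f g.
  by rewrite /wsgn /= andbF !mul1r.
have -> v : wsgn q (wmul f g) (t :: v) = wder t (wsgn q (wmul f g)) v by [].
rewrite wder_sgn wder_mul wsgnD /= !IH !wder_sgn wmulZl wmulZr /= mulrDr.
by rewrite wsgnC.
Qed.

(** Both bracketings obey the same recursion under [wder]; the terms match because [wsgn] is
    multiplicative. *)
Lemma wmulA f g h : wmul f (wmul g h) = wmul (wmul f g) h.
Proof.
apply: funext => w; elim: w f g h => [|t w IH] f g h /=; first by rewrite mulrA.
by rewrite !wder_mul wmulDl wmulDr /= wsgn_mul !IH addrA.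
Qed.

Lemma wcst_mul c f : wmul (wcst c) f = c \*o f.
Proof.
apply: funext => w; elim: w c f => [|t w IH] c f //=.
have -> : wsgn (p t) (wcst c) = wcst c.
  by apply: funext => -[|u v]; rewrite /wsgn /= ?andbF ?mul1r ?mulr0.
have -> : wder t (wcst c) = 0 \*o wcst 0.
  by apply: funext => v /=; rewrite mul0r.
by rewrite wmulZl /= mul0r add0r IH.
Qed.

Lemma mul_wcst c f : wmul f (wcst c) = c \*o f.
Proof.
apply: funext => w; elim: w c f => [|t w IH] c f /=; first by rewrite mulrC.
have -> : wder t (wcst c) = 0 \*o wcst 0.
  by apply: funext => v /=; rewrite mul0r.
by rewrite wmulZr /= mul0r addr0 IH.
Qed.

Definition wparity q f := forall w, f w != 0 -> wpar w = q.

Lemma wparity_der q t f : wparity q f -> wparity (q (+) p t) (wder t f).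
Proof. by move=> hf w /hf /= <-; rewrite addbC addKb. Qed.

Lemma wsgn_parity q q' f : wparity q' f -> wsgn q f = (-1) ^+ (q && q') \*o f.
Proof.
move=> hf; apply: funext => w; rewrite /wsgn /=.
by have [->|/hf ->] := eqVneq (f w) 0; rewrite ?mulr0.
Qed.

Lemma wmulC q q' f g : wparity q f -> wparity q' g ->
  wmul f g = (-1) ^+ (q && q') \*o wmul g f.
Proof.
move=> hf hg; apply: funext => w.
elim: w q q' f g hf hg => [|t w IH] q q' f g hf hg /=.
  case: (eqVneq (f [::]) 0) => [->|/hf /= <-]; first by rewrite mulr0 mul0r mulr0.
  by rewrite mul1r mulrC.
rewrite (IH _ _ _ _ (wparity_der hf) hg).
rewrite (wsgn_parity _ hf) (wsgn_parity _ hg) !wmulZl /=.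
rewrite (IH _ _ _ _ hf (wparity_der hg)) /= mulrDr addrC.
by rewrite !mulrA -!signr_addb; case: q q' (p t) {hf hg} => [] [] [].
Qed.

Definition wsym f := forall w1 w2 a b,
  f (w1 ++ a :: b :: w2) = (-1) ^+ (p a && p b) * f (w1 ++ b :: a :: w2).

Lemma wsym_der t f : wsym f -> wsym (wder t f).
Proof. by move=> hf w1; apply: (hf (t :: w1)). Qed.

Lemma wpar_cat w1 w2 : wpar (w1 ++ w2) = wpar w1 (+) wpar w2.
Proof. by elim: w1 => //= t w1 ->; rewrite addbA. Qed.

Lemma wsym_sgn q f : wsym f -> wsym (wsgn q f).
Proof.
move=> hf w1 w2 a b; rewrite /wsgn (hf w1) mulrCA !wpar_cat /=.
by rewrite (addbCA (p a)).
Qed.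

Lemma wsymP f : wsym f ->
  forall a b, wder b (wder a f) = (-1) ^+ (p a && p b) \*o wder a (wder b f).
Proof. by move=> hf a b; apply: funext => w; apply: (hf [::]). Qed.

Lemma wsym_mul f g : wsym f -> wsym g -> wsym (wmul f g).
Proof.
move=> hf hg w1; elim: w1 f g hf hg => [|t w1 IH] f g hf hg w2 a b /=; last first.
  by rewrite mulrDr (IH _ _ (wsym_der t hf) hg)
    (IH _ _ (wsym_sgn _ hf) (wsym_der t hg)).
(* Two contractions give four terms. Where one factor takes both letters, its own symmetry gives the
   sign; the two mixed terms are exchanged. *)
rewrite !wder_sgn (wsymP hf) (wsymP hg) !wmulZl !wmulZr /= (wsgnC (p a)) andbC.
rewrite !mulrDr addrACA (mulrA (_ ^+ _)) -signr_addb addbb mul1r.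
by congr (_ + _); rewrite addrC -!addrA; congr (_ + _); rewrite addrC.
Qed.

Lemma wsym_cst c : wsym (wcst c).
Proof. by move=> [|? ?] w2 a b /=; rewrite mulr0. Qed.

Definition wvan (k : nat) f := forall w, (size w < k)%N -> f w = 0.

Lemma wvan_mul k l f g : wvan k f -> wvan l g -> wvan (k + l) (wmul f g).
Proof.
move=> hf hg w; elim: w k l f g hf hg => [|t w IH] k l f g hf hg /=.
  case: k hf => [|k] hf; last by rewrite (hf [::]) ?mul0r.
  by case: l hg => [|l] hg // _; rewrite (hg [::]) ?mulr0.
move=> hw; rewrite (IH k.-1 l) ?(IH k l.-1) ?addr0 //.
- by move=> v hv; rewrite /wsgn hf ?mulr0.
- by move=> v hv; apply: hg => /=; case: (l) hv.
- case: (l) hw => [|l'] /=; last by rewrite addnS ltnS.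
  by rewrite addn0; apply: ltnW.
- by move=> v hv; apply: hf => /=; case: (k) hv.
- by case: (k) hw => [|k'] //=; apply: ltnW.
Qed.

End Words.

Lemma wmul_map (K : fieldType) (T T' : Type) (p : T -> bool) (p' : T' -> bool)
    (k : T -> T') (f g : seq T' -> K) : p' \o k =1 p ->
  wmul p (f \o map k) (g \o map k) = wmul p' f g \o map k.
Proof.
move=> kP; apply: funext => w; elim: w f g => [|t w IH] f g //=.
have hE h : wder t (h \o map k) = wder (k t) h \o map k by [].
have -> : wsgn p (p t) (f \o map k) = wsgn p' (p t) f \o map k.
  apply: funext => v; rewrite /wsgn /=; congr ((-1) ^+ (_ && _) * _).
  by elim: v => //= u v ->; rewrite -kP.
by rewrite !hE !IH -[p t]kP.
Qed.

(** * Shuffles and Koszul signs *)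

Definition podd (z : int) : bool := odd `|z|%N.

Lemma poddN z : podd (- z) = podd z.
Proof. by rewrite /podd abszN. Qed.

Lemma poddM x y : podd (x * y) = podd x && podd y.
Proof. by rewrite /podd abszM oddM. Qed.

Lemma exprz_podd (K : fieldType) (z : int) : (-1) ^ z = (-1) ^+ podd z :> K.
Proof.
rewrite /podd signr_odd; case: z => n //=.
by rewrite -[LHS]/(((-1) ^+ n.+1)^-1) invr_sign.
Qed.

Lemma poddD x y : podd (x + y) = podd x (+) podd y.
Proof.
have /eqP : ((-1) ^ (x + y) = (-1) ^+ (podd x (+) podd y) :> rat).
  by rewrite expfzDr // !exprz_podd signr_addb.
by rewrite exprz_podd; case: (podd (x + y)) (_ (+) _) => [] [].
Qed.

Lemma podd1 : podd 1 = true. Proof. by []. Qed.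
Lemma podd0 : podd 0 = false. Proof. by []. Qed.

Lemma podd_sum (I : Type) (r : seq I) (P : pred I) (F : I -> int) :
  podd (\sum_(i <- r | P i) F i) = \big[addb/false]_(i <- r | P i) podd (F i).
Proof. exact: (big_morph _ poddD). Qed.

Lemma wpar_sumz (T : Type) (deg : T -> int) w :
  wpar (podd \o deg) w = podd (sumz (map deg w)).
Proof.
by elim: w => [|t w IH]; rewrite /sumz ?big_nil // big_cons poddD -IH.
Qed.

Lemma wpar_rev (T : Type) (p : T -> bool) w : wpar p (rev w) = wpar p w.
Proof.
by elim: w => //= t w IH; rewrite rev_cons -cats1 wpar_cat IH /= addbF addbC.
Qed.

Section Shuffle.
Variables (n : nat).

(** Permutations are sorted by the position [j] of the largest value; injectivity suffices since
    [(n+1)! = (n+1) n!]. *)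
Lemma sum_lift_perm (V : nmodType) (F : 'S_n.+1 -> V) :
  \sum_(s : 'S_n.+1) F s = \sum_(j : 'I_n.+1) \sum_(s : 'S_n) F (lift_perm j ord_max s).
Proof.
rewrite pair_bigA /=; apply: reindex; apply: onW_bij; apply: inj_card_bij.
  move=> [j s] [j' s'] /= /permP E.
  have ej : j = j'.
    have := E j; rewrite lift_perm_id; case: (unliftP j' j) => [k|] -> //.
    by rewrite lift_perm_lift => /eqP; rewrite (negPf (neq_lift _ _)).
  rewrite -{}ej in E *; congr (_, _); apply/permP => k.
  by have := E (lift j k); rewrite !lift_perm_lift => /lift_inj.
by rewrite card_prod !card_Sn card_ord factS.
Qed.

Lemma lift_ltn (j : 'I_n.+1) (a b : 'I_n) : (lift j a < lift j b)%N = (a < b)%N.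
Proof. by rewrite !ltnNge leq_bump2. Qed.

(* In a shuffle the largest index comes last in one of the two blocks. *)
Lemma shuffle_lift i (j : 'I_n.+1) (s : 'S_n) :
  (i <= n.+1)%N ->
  shuffle i (lift_perm j ord_max s) =
    if i == j.+1 then shuffle j s else [&& val j == n, (i <= n)%N & shuffle i s].
Proof.
move=> ile; set S := lift_perm j ord_max s.
have shP m (t : 'S_m) k : reflect (forall a b : 'I_m, (a < b)%N -> (b < k)%N || (k <= a)%N ->
    (t a < t b)%N) (shuffle k t).
  apply: (iffP forallP) => [H a b ab kab|H a].
    by have /forallP/(_ b)/implyP := H a; apply; rewrite ab.
  by apply/forallP => b; apply/implyP => /andP[]; apply: H.
have Smax k : (S (lift j k) < S j)%N.
  by rewrite /S lift_perm_lift lift_perm_id lift_max /=.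
have SS a b : (S (lift j a) < S (lift j b))%N = (s a < s b)%N.
  by rewrite /S !lift_perm_lift lift_ltn.
case: eqP => [->|/eqP neq].
  apply/shP/shP => H a b.
    move=> ab h; rewrite -SS; apply: H; first by rewrite lift_ltn.
    rewrite /= /bump; case: (leqP j b) h => jb /=.
      by move=> ja; rewrite ja /= orbC add1n ltnS ja.
    by move=> _; rewrite add0n ltnS ltnW.
  case: (unliftP j a) => [a'|] ->; case: (unliftP j b) => [b'|] ->.
  - rewrite lift_ltn SS => ab h; apply: (H _ _ ab); move: h; rewrite /= /bump.
    case: (leqP j a') => ja; case: (leqP j b') => jb //.
    by rewrite add1n add0n ltnS => /orP[|/ltnW]; rewrite leqNgt ?ja // ltnS jb.
  - by move=> _ _; apply: Smax.
  - move=> jb /orP[]; rewrite /= ?ltnn //.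
    by rewrite ltnS leqNgt jb.
  - by rewrite ltnn.
apply/shP/and3P => [H|[/eqP jn ilen /shP H] a b].
  (* Position [j] carries the largest value. If there were a position [j + 1], it would lie in the
     same block, because [i != j + 1], and would have to carry a larger one. *)
  have jn : val j == n.
    rewrite eqn_leq leq_ord /= leqNgt; apply/negP => jn.
    have j1 : (j.+1 < n.+1)%N by [].
    have := H j (Ordinal j1) (leqnn _) => /=.
    have : (S (Ordinal j1) < S j)%N.
      case: (unliftP j (Ordinal j1)) => [k ->|/(congr1 val) /= /eqP]; first exact: Smax.
      by rewrite eqn_leq ltnn.
    suff -> : (j.+1 < i)%N || (i <= j)%N.
      by move=> lt1 /(_ isT) lt2; have := ltn_trans lt1 lt2; rewrite ltnn.
    by case: ltngtP neq => //= h _; rewrite -ltnS.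
  have ilen : (i <= n)%N.
    by rewrite -ltnS ltn_neqAle ile andbT -(eqP jn).
  split=> //; apply/shP => a b ab h; rewrite -SS; apply: H.
    by rewrite lift_ltn.
  have jj : j = ord_max by apply: val_inj; apply: (eqP jn).
  by rewrite jj !lift_max.
have jj : j = ord_max by apply: val_inj.
case: (unliftP j a) => [a'|] ->; case: (unliftP j b) => [b'|] ->.
- by rewrite lift_ltn SS jj !lift_max; apply: H.
- by move=> _ _; apply: Smax.
- by rewrite jj ltnNge leq_ord.
- by rewrite ltnn.
Qed.

End Shuffle.

Section ShuffleSum.
Variables (K : fieldType) (T : Type) (deg : T -> int).

Definition iword n (z : 'I_n -> T) (s : 'S_n) : seq T := [seq z (s a) | a <- enum 'I_n].

Lemma size_iword n (z : 'I_n -> T) s : size (iword z s) = n.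
Proof. by rewrite size_map size_enum_ord. Qed.

Lemma iword_lift n (z : 'I_n.+1 -> T) (j : 'I_n.+1) (s : 'S_n) :
  let w := iword (z \o lift ord_max) s in
  iword z (lift_perm j ord_max s) = take j w ++ z ord_max :: drop j w.
Proof.
move=> w; have sw : size w = n by apply: size_iword.
have jn : (j <= n)%N by rewrite -ltnS.
have szt : size (take j w) = j by rewrite size_takel ?sw.
apply: (@eq_from_nth _ (z ord_max)).
  by rewrite size_iword size_cat /= size_drop szt sw addnS subnKC.
move=> k; rewrite size_iword => kn; rewrite nth_cat szt.
rewrite (nth_map (Ordinal kn)) ?size_enum_ord //.
have -> : nth (Ordinal kn) (enum 'I_n.+1) k = Ordinal kn.
  by rewrite (nth_ord_enum _ (Ordinal kn)).
have nw (l : 'I_n) : nth (z ord_max) w l = z (lift ord_max (s l)).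
  by rewrite (nth_map l) ?size_enum_ord // nth_ord_enum.
case: (unliftP j (Ordinal kn)) => [l|] Ek.
  have kE : k = bump j l by rewrite -[k]/(val (Ordinal kn)) Ek.
  rewrite Ek lift_perm_lift -nw kE /bump; case: (leqP j l) => jl /=.
    by rewrite add1n ltnNge (leq_trans jl) //= subSn //= nth_drop subnKC.
  by rewrite add0n jl nth_take.
have kE : k = j by rewrite -[k]/(val (Ordinal kn)) Ek.
by rewrite Ek lift_perm_id kE ltnn subnn.
Qed.

Definition ksgn n (D : 'I_n -> int) (s : 'S_n) : K :=
  \prod_(q : 'I_n * 'I_n | (q.1 < q.2)%N && (s q.2 < s q.1)%N)
     (-1) ^+ podd (D (s q.1) * D (s q.2)).

Lemma ksgnE n (D : 'I_n -> int) (s : 'S_n) :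
  ksgn D s = \prod_(a < n) \prod_(b < n) (if (a < b)%N && (s b < s a)%N
    then (-1) ^+ podd (D (s a) * D (s b)) else 1).
Proof. by rewrite /ksgn big_mkcond pair_bigA. Qed.

(** The largest value stands at position [j], so it is inverted exactly with the later positions;
    all other inversions are those of [s]. *)
Lemma ksgn_lift n (D : 'I_n.+1 -> int) (j : 'I_n.+1) (s : 'S_n) :
  ksgn D (lift_perm j ord_max s) =
    (-1) ^+ (podd (D ord_max) &&
       podd (sumz (drop j [seq D (lift ord_max (s a)) | a <- enum 'I_n])))
    * ksgn (D \o lift ord_max) s.
Proof.
rewrite !ksgnE.
pose E (t : 'S_n.+1) (a b : 'I_n.+1) := if (a < b)%N && (t b < t a)%N then
  (-1) ^+ podd (D (t a) * D (t b)) else 1 : K.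
rewrite -[X in X = _]/(\prod_(a < n.+1) \prod_(b < n.+1) E (lift_perm j ord_max s) a b).
rewrite (bigD1_ord j) //=; congr (_ * _).
  rewrite (bigD1_ord j) //= {1}/E ltnn /= mul1r.
  transitivity (\prod_(b < n) ((-1) ^+ ((j <= b)%N && podd (D ord_max * D (lift ord_max (s b)))) : K)).
    apply: eq_bigr => b _; rewrite /E lift_perm_id lift_perm_lift lift_max /= ltn_ord andbT.
    have -> : (j < bump j b)%N = (j <= b)%N.
      rewrite /bump; case: (leqP j b) => jb; rewrite ?add1n ?ltnS //.
      by rewrite add0n ltnNge ltnW.
    by case: ifP.
  rewrite -(big_morph (fun c => (-1) ^+ nat_of_bool c : K) (id2 := false)
    (op2 := addb)) //; last exact: signr_addb.
  congr (_ ^+ nat_of_bool _); rewrite /sumz podd_sum.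
  rewrite -[in RHS]map_drop big_map.
  have -> : drop j (enum 'I_n) = [seq a : 'I_n <- enum 'I_n | (j <= a)%N].
    apply: (inj_map val_inj); rewrite map_drop val_enum_ord.
    rewrite -(filter_map val (fun a => j <= a)%N) val_enum_ord.
    have -> : iota 0 n = iota 0 j ++ iota j (n - j).
      by rewrite -iotaD subnKC // -ltnS.
    rewrite drop_size_cat ?size_iota // filter_cat [X in X ++ _](eq_in_filter (a2 := pred0)).
      by rewrite filter_pred0 (all_filterP _) //; apply/allP => k; rewrite mem_iota => /andP[].
    by move=> k; rewrite mem_iota add0n /= ltnNge => /negPf.
  rewrite big_filter big_enum_cond /= (big_morph _ (andb_addr (podd (D ord_max))) (andbF _)).
  by rewrite [RHS]big_mkcond; apply: eq_bigr => b _; rewrite poddM; case: ifP.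
apply: eq_bigr => a _; rewrite (bigD1_ord j) //=.
rewrite {1}/E lift_perm_id lift_perm_lift lift_max [(n < s a)%N]ltnNge [(s a <= n)%N]ltnW // andbF mul1r.
by apply: eq_bigr => b _; rewrite /E lift_ltn !lift_perm_lift lift_ltn.
Qed.

Definition shterm n (z : 'I_n -> T) (F G : seq T -> K) (i : nat) (s : 'S_n) : K :=
  let w := iword z s in
  ksgn (deg \o z) s * (-1) ^+ (podd (sumz (map deg (take i w)) * sumz (map deg (drop i w)))) *
    (F (take i w) * G (drop i w)).

(** The link between the product of the statement and [wmul], by induction on the number of
    arguments: the last argument closes either the first block or the second, and these cases are
    the two terms of the Leibniz rule. *)
Lemma shuffle_sum n (z : 'I_n -> T) (F G : seq T -> K) :
  \sum_(i < n.+1) \sum_(s : 'S_n | shuffle i s) shterm z F G i s =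
  wmul (podd \o deg) (F \o rev) (G \o rev) (rev [seq z a | a <- enum 'I_n]).
Proof.
elim: n z F G => [|n IH] z F G.
  rewrite big_ord1 (bigD1 1%g) /=; last by apply/forallP => -[].
  rewrite big1 ?addr0; last first.
    by move=> s /andP[_ /eqP[]]; apply/permP => -[].
  rewrite /shterm /ksgn big_pred0; last by case=> -[].
  have -> : enum 'I_0 = [::] by apply: size0nil; rewrite size_enum_ord.
  have -> : iword z 1%g = [::] by apply: size0nil; rewrite size_iword.
  by rewrite /sumz /= !big_nil mulr0 podd0 mulr1 !mul1r.
rewrite enum_ordSr map_rcons rev_rcons -map_comp.
have -> : [seq (z \o widen_ord (leqnSn n)) i | i <- enum 'I_n] =
          [seq (z \o lift ord_max) i | i <- enum 'I_n].
  apply: eq_map => a /=; congr z; apply: val_inj; by rewrite [RHS]lift_max.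
set z' := z \o lift ord_max; set v := z ord_max.
pose Fs := fun w => (-1) ^+ (podd (deg v) && podd (sumz (map deg w))) * F w.
rewrite [RHS]/=.
have -> : wder v (F \o rev) = (fun w => F (rcons w v)) \o rev.
  by apply: funext => w; rewrite /wder /= rev_cons.
have -> : wder v (G \o rev) = (fun w => G (rcons w v)) \o rev.
  by apply: funext => w; rewrite /wder /= rev_cons.
have -> : wsgn (podd \o deg) (podd (deg v)) (F \o rev) = Fs \o rev.
  by apply: funext => w; rewrite /wsgn /Fs /= -wpar_sumz wpar_rev.
rewrite -!IH.
under eq_bigr => i _.
  rewrite big_mkcond sum_lift_perm /=.
  under eq_bigr => j _.
    under eq_bigr => s _.
      rewrite shuffle_lift; last by rewrite -ltnS.
      (* The two kinds of shuffle exclude each other, as [i = j + 1] and [j = n] contradict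
         [i <= n], so the conditional is a sum. *)
      rewrite (_ : (if _ then _ else _) =
        (if (val i == j.+1) && shuffle j s then shterm z F G i (lift_perm j ord_max s) else 0) +
        (if [&& val j == n, (i <= n)%N & shuffle i s] then shterm z F G i (lift_perm j ord_max s) else 0));
        last first.
        case: eqP => [E|_] /=; last by rewrite add0r.
        case: eqP => [jn|_] /=; last by rewrite addr0.
        by rewrite E jn ltnn /= addr0.
      over.
    rewrite big_split /=; over.
  rewrite big_split /=; over.
rewrite big_split /=; congr (_ + _).
  rewrite exchange_big; apply: eq_bigr => j _.
  rewrite (bigD1 (lift ord0 j)) //= [X in _ + X]big1 ?addr0; last first.
    move=> i; rewrite -(inj_eq val_inj) /= => /negPf ij.
    by apply: big1 => s _; rewrite -[bump 0 j]/(j.+1) in ij; rewrite ij.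
  rewrite -[bump 0 j]/(j.+1) eqxx /= -big_mkcond; apply: eq_bigr => s _.
  rewrite /shterm iword_lift -/z' -/v.
  have jw : (j <= size (iword z' s))%N by rewrite size_iword -ltnS.
  have szt : size (take j (iword z' s)) = j by rewrite size_takel.
  rewrite -cat_rcons !take_size_cat ?drop_size_cat ?size_rcons ?szt //.
  congr (_ * (_ * _)); rewrite ksgn_lift -/z' -[drop _ [seq _ | _ <- _]]map_drop.
  rewrite -/z' /= (_ : [seq deg (z (lift ord_max (s a))) | a <- drop j (enum 'I_n)] =
    map deg (drop j (iword z' s))); last by rewrite /iword -map_drop -map_comp.
  set A := sumz (map deg (take j _)); set B := sumz (map deg (drop j _)).
  have -> : sumz [seq deg i | i <- rcons (take j (iword z' s)) v] = A + deg v.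
    by rewrite map_rcons /sumz -cats1 big_cat big_seq1.
  (* Here [v] closes the first block: the sign [(-1)^(|v| B)] of standing before the second block
     cancels its share in the tensor sign [(-1)^((A + |v|) B)]. *)
  rewrite mulrAC mulrC -/v -signr_addb !poddM poddD [podd A && _]andbC andb_addl.
  congr (_ * (_ ^+ nat_of_bool _)).
  by case: (podd A) (podd B) (podd (deg v)) => [] [] [].
rewrite [RHS](eq_bigr _ (fun i _ => big_mkcond _ _)).
rewrite big_ord_recr /= [X in _ + X]big1 ?addr0; last first.
  by move=> j _; apply: big1 => s _; rewrite ltnn andbF.
apply: eq_bigr => i _; rewrite (bigD1 ord_max) //= [X in _ + X]big1 ?addr0; last first.
  move=> j; rewrite -(inj_eq val_inj) /= => /negPf ij.
  by apply: big1 => s _; rewrite ij.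
apply: eq_bigr => s _; rewrite eqxx /= -ltnS ltn_ord /=; case: ifP => // _.
have iw : (i <= size (iword z' s))%N by rewrite size_iword -ltnS.
rewrite /shterm iword_lift -/z' -/v /=.
have sw : size (iword z' s) = n by apply: size_iword.
rewrite [take n _]take_oversize ?sw // [drop n _]drop_oversize ?sw //.
rewrite takel_cat // drop_cat.
rewrite (_ : (if _ then _ else _) = rcons (drop i (iword z' s)) v); last first.
  case: ltnP => h; first by rewrite cats1.
  have -> : (i - size (iword z' s) = 0)%N by apply/eqP; rewrite subn_eq0.
  by rewrite drop0 [drop i _]drop_oversize.
rewrite ksgn_lift [drop ord_max _]drop_oversize ?size_map -?enumT ?size_enum_ord //.
rewrite {1}/sumz big_nil andbF mul1r.
rewrite map_rcons {2}/sumz -cats1 big_cat big_seq1 /= -/(sumz _) /Fs.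
set A := sumz _; set B := sumz _.
(* Here [v] closes the second block and has nothing after it; the tensor sign [(-1)^(A (B + |v|))]
   supplies the factor [(-1)^(A |v|)] put into [Fs]. *)
rewrite mulrDr poddD signr_addb !poddM [podd A && podd (deg v)]andbC.
by rewrite -!mulrA; congr (_ * (_ * _)); rewrite mulrA.
Qed.

End ShuffleSum.

(** * The ring of graded symmetric formal power series *)

(* Unlike the functions of the statement, these have a component of arity 0, so
   that they form a unital ring. *)
Record fps (K : fieldType) (n : nat) (dg : 'I_n -> int) := Fps {
  fpsval :> seq 'I_n -> K;
  fps_sym : wsym (podd \o dg) fpsval
}.
Arguments Fps {K n dg} _ _.

Section Fps.
Variables (K : fieldType) (n : nat) (dg : 'I_n -> int).
Local Notation A := (fps K dg).
Local Notation p := (podd \o dg).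
Implicit Types (f g h : A) (a b : 'I_n) (w : seq 'I_n).

Lemma fpsP f g : fpsval f =1 fpsval g -> f = g.
Proof.
case: f g => [f hf] [g hg] /= /funext E; rewrite {}E in hf *.
by congr Fps; apply: Prop_irrelevance.
Qed.

HB.instance Definition _ := gen_eqMixin A.
HB.instance Definition _ := gen_choiceMixin A.

Definition fps_cst c : A := Fps (wcst c) (@wsym_cst _ _ _ c).

Definition fps_opp f : A.
Proof.
by exists (fun w => - f w) => w1 w2 a b; rewrite (fps_sym f) mulrN.
Defined.

Definition fps_add f g : A.
Proof.
by exists (f \+ g) => w1 w2 a b /=; rewrite (fps_sym f) (fps_sym g) mulrDr.
Defined.

Definition fps_mul f g : A := Fps (wmul p f g) (wsym_mul (fps_sym f) (fps_sym g)).

Let cst0E w : fps_cst 0 w = 0. Proof. by case: w. Qed.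

Lemma fps_addA : associative fps_add.
Proof. by move=> f g h; apply: fpsP => w /=; rewrite addrA. Qed.
Lemma fps_addC : commutative fps_add.
Proof. by move=> f g; apply: fpsP => w /=; rewrite addrC. Qed.
Lemma fps_add0 : left_id (fps_cst 0) fps_add.
Proof. by move=> f; apply: fpsP => -[|? ?] /=; rewrite add0r. Qed.
Lemma fps_addN : left_inverse (fps_cst 0) fps_opp fps_add.
Proof. by move=> f; apply: fpsP => -[|? ?] /=; rewrite addNr. Qed.

HB.instance Definition _ := GRing.isZmodule.Build A
  fps_addA fps_addC fps_add0 fps_addN.

Lemma fps_mulA : associative fps_mul.
Proof. by move=> f g h; apply: fpsP => w /=; rewrite wmulA. Qed.
Lemma fps_mul_1l : left_id (fps_cst 1) fps_mul.
Proof. by move=> f; apply: fpsP => w /=; rewrite wcst_mul /= mul1r. Qed.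
Lemma fps_mul_1r : right_id (fps_cst 1) fps_mul.
Proof. by move=> f; apply: fpsP => w /=; rewrite mul_wcst /= mul1r. Qed.
Lemma fps_mulDl : left_distributive fps_mul +%R.
Proof. by move=> f g h; apply: fpsP => w /=; rewrite wmulDl. Qed.
Lemma fps_mulDr : right_distributive fps_mul +%R.
Proof. by move=> f g h; apply: fpsP => w /=; rewrite wmulDr. Qed.
Lemma fps_1neq0 : fps_cst 1 != 0.
Proof. by apply/eqP => /(congr1 (fun f : A => f [::])) /= /eqP; rewrite oner_eq0. Qed.

HB.instance Definition _ := GRing.Zmodule_isNzRing.Build A
  fps_mulA fps_mul_1l fps_mul_1r fps_mulDl fps_mulDr fps_1neq0.

Lemma fps0E w : (0 : A) w = 0. Proof. exact: cst0E. Qed.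
Lemma fpsDE f g w : (f + g) w = f w + g w. Proof. by []. Qed.
Lemma fpsNE f w : (- f) w = - f w. Proof. by []. Qed.
Lemma fpsBE f g w : (f - g) w = f w - g w. Proof. by []. Qed.
Lemma fpsME f g : fpsval (f * g) = wmul p f g. Proof. by []. Qed.
Lemma fps1E : (1 : A) = fps_cst 1. Proof. by []. Qed.

Lemma fps_sumE (I : Type) (r : seq I) (P : pred I) (F : I -> A) w :
  (\sum_(i <- r | P i) F i) w = \sum_(i <- r | P i) F i w.
Proof.
exact: (big_morph (fun f : A => f w) (fun f g => fpsDE f g w) (fps0E w)).
Qed.

Lemma fps_signE (q : bool) f w : ((-1) ^+ q * f) w = (-1) ^+ q * f w.
Proof. by case: q; rewrite ?mul1r // !mulN1r fpsNE. Qed.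

Lemma fps_cst_is_additive : zmod_morphism fps_cst.
Proof. by move=> c d; apply: fpsP => -[|? ?]; rewrite !fpsBE //= subr0. Qed.
HB.instance Definition _ := GRing.isZmodMorphism.Build K A fps_cst fps_cst_is_additive.

Lemma fps_cstM c f w : (fps_cst c * f) w = c * f w.
Proof. by rewrite fpsME wcst_mul. Qed.

Lemma fps_cst_is_monoid : monoid_morphism fps_cst.
Proof.
split=> // c d; apply: fpsP => w; rewrite fps_cstM.
by case: w => //= ? ?; rewrite mulr0.
Qed.
HB.instance Definition _ := GRing.isMonoidMorphism.Build K A fps_cst fps_cst_is_monoid.

Lemma fps_cstC c f : fps_cst c * f = f * fps_cst c.
Proof. by apply: fpsP => w; rewrite !fpsME wcst_mul mul_wcst. Qed.

Definition fps_der a f : A := Fps (wder a f) (wsym_der a (fps_sym f)).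

Lemma fps_derE a f w : fps_der a f w = f (a :: w). Proof. by []. Qed.

Lemma fps_der_is_additive a : zmod_morphism (fps_der a).
Proof. by move=> f g; apply: fpsP => w. Qed.
HB.instance Definition _ a :=
  GRing.isZmodMorphism.Build A A (fps_der a) (fps_der_is_additive a).

Lemma fps_der_cst a c : fps_der a (fps_cst c) = 0.
Proof. by apply: fpsP => w; rewrite fps0E. Qed.

Lemma fps_derC a b f : fps_der b (fps_der a f) =
  (-1) ^+ (podd (dg a) && podd (dg b)) * fps_der a (fps_der b f).
Proof. by apply: fpsP => w; rewrite fps_signE /= (wsymP (fps_sym f)). Qed.

(** The coordinate dual to a vector of degree [d] has degree [-d], hence the minus sign; zero has
    every degree. *)
Definition fps_deg (x : int) f := forall w, f w != 0 -> sumz (map dg w) = - x.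

Lemma fps_deg_parity x f : fps_deg x f -> wparity p (podd x) f.
Proof. by move=> hf w /hf; rewrite wpar_sumz => ->; rewrite poddN. Qed.

Lemma fps_deg0 x : fps_deg x 0.
Proof. by move=> w; rewrite fps0E eqxx. Qed.

Lemma fps_degD x f g : fps_deg x f -> fps_deg x g -> fps_deg x (f + g).
Proof.
move=> hf hg w; rewrite fpsDE.
by have [->|/hf //] := eqVneq (f w) 0; rewrite add0r => /hg.
Qed.

Lemma fps_degN x f : fps_deg x f -> fps_deg x (- f).
Proof. by move=> hf w; rewrite fpsNE oppr_eq0 => /hf. Qed.

Lemma fps_degZ x (c : K) f : fps_deg x f -> fps_deg x (fps_cst c * f).
Proof. by move=> hf w; rewrite fps_cstM mulf_eq0 negb_or => /andP[_ /hf]. Qed.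

Lemma fps_deg_sign x (q : bool) f : fps_deg x f -> fps_deg x ((-1) ^+ q * f).
Proof. by move=> hf w; rewrite fps_signE mulf_eq0 negb_or => /andP[_ /hf]. Qed.

Lemma fps_deg_sum x (I : Type) (r : seq I) (P : pred I) (F : I -> A) :
  (forall i, P i -> fps_deg x (F i)) -> fps_deg x (\sum_(i <- r | P i) F i).
Proof.
by move=> hF; apply: big_ind => //; [apply: fps_deg0 | apply: fps_degD].
Qed.

Lemma fps_deg_cst c : fps_deg 0 (fps_cst c).
Proof. by move=> [|a w]; rewrite /= ?eqxx // /sumz big_nil oppr0. Qed.

Lemma fps_deg_der a x f : fps_deg x f -> fps_deg (x + dg a) (fps_der a f).
Proof.
move=> hf w /hf; rewrite /sumz /= big_cons => /eqP.
by rewrite addrC -subr_eq0 opprK -addrA addr_eq0 addrC => /eqP ->; rewrite addrC.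
Qed.

Lemma wmul_deg x y (f g : seq 'I_n -> K) :
  (forall w, f w != 0 -> sumz (map dg w) = - x) ->
  (forall w, g w != 0 -> sumz (map dg w) = - y) ->
  forall w, wmul p f g w != 0 -> sumz (map dg w) = - (x + y).
Proof.
move=> hf hg w; elim: w x y f g hf hg => [|a w IH] x y f g hf hg.
  rewrite /= mulf_eq0 negb_or => /andP[/hf fx /hg gy].
  by rewrite opprD -fx -gy /sumz big_nil addr0.
have dP z (k : seq 'I_n -> K) : (forall v, k v != 0 -> sumz (map dg v) = - z) ->
    forall v, wder a k v != 0 -> sumz (map dg v) = - (z + dg a).
  move=> hk v /hk; rewrite /sumz /= big_cons => E.
  by rewrite opprD -E addrAC subrr add0r.
have sumE : sumz (map dg (a :: w)) = dg a + sumz (map dg w) by rewrite /sumz /= big_cons.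
rewrite sumE /=.
have [->|/(IH _ _ _ _ (dP _ _ hf) hg) -> _] := eqVneq (wmul p (wder a f) g w) 0.
  rewrite add0r => /(IH x (y + dg a)) ->.
  - by ring.
  - by move=> v; rewrite /wsgn mulf_eq0 signr_eq0 /= => /hf.
  - exact: dP.
by ring.
Qed.

Lemma fps_degM x y f g : fps_deg x f -> fps_deg y g -> fps_deg (x + y) (f * g).
Proof. exact: wmul_deg. Qed.

Lemma fps_mulC x y f g : fps_deg x f -> fps_deg y g ->
  f * g = (-1) ^+ (podd x && podd y) * (g * f).
Proof.
move=> hf hg; apply: fpsP => w; rewrite fps_signE !fpsME.
by rewrite (wmulC (fps_deg_parity hf) (fps_deg_parity hg)).
Qed.

Lemma fps_der_mul x a f g : fps_deg x f -> fps_der a (f * g) =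
  fps_der a f * g + (-1) ^+ (podd (dg a) && podd x) * (f * fps_der a g).
Proof.
move=> hf; apply: fpsP => w; rewrite fpsDE fps_signE /= /wder /=; congr (_ + _).
by rewrite (wsgn_parity _ (fps_deg_parity hf)) wmulZl.
Qed.

Lemma fps_signC (q : bool) f : (-1) ^+ q * f = f * (-1) ^+ q.
Proof. by case: q; rewrite ?mul1r ?mulr1 // mulN1r mulrN1. Qed.

Lemma fps_signCA (q : bool) f g : f * ((-1) ^+ q * g) = (-1) ^+ q * (f * g).
Proof. by case: q; rewrite ?mul1r // !mulN1r mulrN. Qed.

Lemma fps_mulCA x y f g h : fps_deg x f -> fps_deg y g ->
  f * (g * h) = (-1) ^+ (podd x && podd y) * (g * (f * h)).
Proof. by move=> hf hg; rewrite mulrA (fps_mulC hf hg) -!mulrA. Qed.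

Lemma fps_signK (q q' : bool) f : (-1) ^+ q * ((-1) ^+ q' * f) = (-1) ^+ (q (+) q') * f.
Proof. by rewrite mulrA -signr_addb. Qed.

Definition fps_X a : A.
Proof.
exists (fun w => if w is [:: b] then (b == a)%:R else 0).
by move=> [|? [|? ?]] [|? ?] b c /=; rewrite mulr0.
Defined.

Lemma fps_deg_X a : fps_deg (- dg a) (fps_X a).
Proof.
move=> [|b [|? ?]] /=; rewrite ?eqxx //.
by case: (eqVneq b a) => [->|]; rewrite ?eqxx // /sumz big_seq1 opprK.
Qed.

Lemma fps_der_X a b : fps_der b (fps_X a) = fps_cst (b == a)%:R.
Proof. by apply: fpsP => -[|? ?]. Qed.

Lemma fps_der_XM a b f : fps_der b (fps_X a * f) = fps_cst (b == a)%:R * f +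
  (-1) ^+ (podd (dg b) && podd (dg a)) * (fps_X a * fps_der b f).
Proof. by rewrite (fps_der_mul _ _ (@fps_deg_X a)) poddN fps_der_X. Qed.

(** The arity filtration, with respect to which convergence is meant. *)
Definition fps_van (k : nat) f := forall w, (size w < k)%N -> f w = 0.

Lemma fps_van0 f : fps_van 0 f. Proof. by []. Qed.

Lemma fps_van_le k l f : (l <= k)%N -> fps_van k f -> fps_van l f.
Proof. by move=> lk hf w wl; apply: hf; apply: leq_trans lk. Qed.

Lemma fps_vanD k f g : fps_van k f -> fps_van k g -> fps_van k (f + g).
Proof. by move=> hf hg w hw; rewrite fpsDE hf ?hg ?addr0. Qed.

Lemma fps_vanN k f : fps_van k f -> fps_van k (- f).
Proof. by move=> hf w hw; rewrite fpsNE hf ?oppr0. Qed.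

Lemma fps_van_sum k (I : Type) (r : seq I) (P : pred I) (F : I -> A) :
  (forall i, P i -> fps_van k (F i)) -> fps_van k (\sum_(i <- r | P i) F i).
Proof.
move=> hF; apply: big_ind => [w _|f g|]; [exact: fps0E | exact: fps_vanD | by []].
Qed.

Lemma fps_van_sign k (q : bool) f : fps_van k f -> fps_van k ((-1) ^+ q * f).
Proof. by move=> hf w hw; rewrite fps_signE hf ?mulr0. Qed.

Lemma fps_vanM k l f g : fps_van k f -> fps_van l g -> fps_van (k + l) (f * g).
Proof. exact: wvan_mul. Qed.

Lemma fps_van_der a k f : fps_van k f -> fps_van k.-1 (fps_der a f).
Proof. by move=> hf w hw; apply: hf; case: k hw. Qed.

(** The Euler field counts arguments: contracting with [b] reproduces the sum for [fps_der b f] plus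
    one extra [fps_der b f], coming from the derivative of [fps_X b] itself. *)
Lemma fps_euler f w : (\sum_a fps_X a * fps_der a f) w = (size w)%:R * f w.
Proof.
elim: w f => [|b w IH] f.
  by rewrite fps_sumE big1 ?mul0r // => a _; rewrite fpsME /= mul0r.
rewrite -fps_derE.
have -> : fps_der b (\sum_a fps_X a * fps_der a f) =
    fps_der b f + \sum_a fps_X a * fps_der a (fps_der b f).
  rewrite raddf_sum /=.
  under eq_bigr do rewrite fps_der_XM fps_derC.
  rewrite big_split; congr (_ + _) => /=.
    rewrite (bigD1 b) //= eqxx rmorph1 mul1r big1 ?addr0 // => a /negPf.
    by rewrite eq_sym => ->; rewrite rmorph0 mul0r.
  apply: eq_bigr => a _; rewrite [fps_X _ * _]mulrA -[fps_X _ * _ ^+ _]fps_signC.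
  by rewrite !mulrA andbC -signr_addb addbb mul1r.
by rewrite fpsDE IH !fps_derE -[size (b :: w)]addn1 natrD mulrDl mul1r addrC.
Qed.

Definition fps_part (k : nat) f : A.
Proof.
exists (fun w => if size w == k then f w else 0) => w1 w2 a b.
by rewrite !size_cat /=; case: eqP => _; rewrite ?mulr0 // (fps_sym f).
Defined.

End Fps.

(* Euler's formula writes a homogeneous part [f] of arity [k] as
   [k^-1 \sum_a X_a (der_a f)], so [D] is determined through induction on the arity. *)
Lemma fps_operator_eq0 (K : fieldType) (n m : nat) (dg : 'I_n -> int)
    (dg' : 'I_m -> int) (D : fps K dg -> fps K dg') (psi : 'I_n -> fps K dg') :
  (forall k, k.+1%:R != 0 :> K) ->
  {morph D : f g / f + g} ->
  (forall c f, D (fps_cst dg c * f) = fps_cst dg' c * D f) ->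
  D 1 = 0 ->
  (forall a f, D (fps_X K dg a * f) = psi a * D f) ->
  (forall k f, fps_van k f -> fps_van k.-1 (D f)) ->
  forall f, D f = 0.
Proof.
move=> char0 DD DZ D1 DX Dvan f.
have D0 : D 0 = 0.
  by have := DZ 0 0; rewrite !rmorph0 !mul0r.
have Dsum := big_morph D DD D0.
have part0 k g : D (fps_part k g) = 0.
  have : forall w, size w != k -> fps_part k g w = 0.
    by move=> w /= /negPf ->.
  move: (fps_part k g) => {}g.
  elim: k g => [|k IH] g hg.
    have -> : g = fps_cst dg (g [::]) * 1.
      by rewrite mulr1; apply: fpsP => -[|a w] //=; apply: hg.
    by rewrite DZ D1 mulr0.
  have -> : g = fps_cst dg (k.+1%:R^-1) * \sum_a fps_X K dg a * fps_der a g.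
    apply: fpsP => w; rewrite fps_cstM fps_euler.
    have [->|/hg ->] := eqVneq (size w) k.+1; last by rewrite !mulr0.
    by rewrite mulrA mulVf ?mul1r.
  rewrite DZ Dsum big1 ?mulr0 // => a _; rewrite DX IH ?mulr0 // => w hw.
  by apply: hg.
apply: fpsP => w; rewrite fps0E.
(* [D] may lower the order of vanishing by one, so the truncation has to agree with [f] up to arity
   [size w + 1]. *)
pose N := (size w).+2.
have -> : f = (f - \sum_(k < N) fps_part k f) + \sum_(k < N) fps_part k f.
  by rewrite subrK.
rewrite DD Dsum [X in _ + X]big1; last by move=> k _; apply: part0.
rewrite addr0; apply: (Dvan N) => // v hv; rewrite fpsBE fps_sumE.
rewrite (bigD1 (Ordinal hv)) //= eqxx big1 ?addr0 ?subrr // => k.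
by rewrite -(inj_eq val_inj) /= eq_sym => /negPf ->.
Qed.

(** * Vector fields, pullbacks and supermatrices *)

(** By [vf_van] the arity is never lowered, so the field vanishes at the origin, as [Q_E] does in
    the absence of a bracket [l_0]. *)
Record vfield (K : fieldType) (n : nat) (dg : 'I_n -> int) := VField {
  vf :> fps K dg -> fps K dg;
  vf_add : zmod_morphism vf;
  vf_cst : forall c, vf (fps_cst dg c) = 0;
  vfM : forall x f g, fps_deg x f ->
    vf (f * g) = vf f * g + (-1) ^+ podd x * (f * vf g);
  vf_deg : forall x f, fps_deg x f -> fps_deg (x + 1) (vf f);
  vf_van : forall k f, fps_van k f -> fps_van k (vf f)
}.

Arguments vfM {K n dg} v [x f] g _.
Arguments vf_deg {K n dg} v [x f] _.
Arguments vf_van {K n dg} v [k f] _.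

HB.instance Definition _ K n dg (Q : @vfield K n dg) :=
  GRing.isZmodMorphism.Build _ _ Q (vf_add Q).

Record fpsmor (K : fieldType) (m n : nat) (dg' : 'I_m -> int) (dg : 'I_n -> int) :=
  FpsMor {
  pb :> fps K dg' -> fps K dg;
  pb_add : zmod_morphism pb;
  pb_cst : forall c, pb (fps_cst dg' c) = fps_cst dg c;
  pb_mul : {morph pb : f g / f * g};
  pb_deg : forall x f, fps_deg x f -> fps_deg x (pb f);
  pb_van : forall k f, fps_van k f -> fps_van k (pb f)
}.

Arguments pb_deg {K m n dg' dg} _ [x f] _.
Arguments pb_van {K m n dg' dg} _ [k f] _.

HB.instance Definition _ K m n dg' dg (P : @fpsmor K m n dg' dg) :=
  GRing.isZmodMorphism.Build _ _ P (pb_add P).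

Lemma pb_monoid K m n dg' dg (P : @fpsmor K m n dg' dg) : monoid_morphism P.
Proof. by split; [rewrite !fps1E pb_cst | apply: pb_mul]. Qed.
HB.instance Definition _ K m n dg' dg (P : @fpsmor K m n dg' dg) :=
  GRing.isMonoidMorphism.Build _ _ P (pb_monoid P).

Section ChainRules.
Variables (K : fieldType) (char0 : forall k, k.+1%:R != 0 :> K).

(** The difference of the two sides is a derivation killing the coordinates, so it passes [fps_X a]
    up to sign and [fps_operator_eq0] applies. *)
Lemma vf_chain n (dg : 'I_n -> int) (Q : vfield K dg) f :
  Q f = \sum_a Q (fps_X K dg a) * fps_der a f.
Proof.
pose D f := Q f - \sum_a Q (fps_X K dg a) * fps_der a f.
apply/eqP; rewrite -subr_eq0; apply/eqP; rewrite -/(D f).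
apply: (fps_operator_eq0 (psi := fun a => (-1) ^+ podd (dg a) * fps_X K dg a)) => //.
- move=> {}f g; rewrite /D raddfD /= addrACA; congr (_ + _).
  rewrite -opprD -big_split /=; congr (- _); apply: eq_bigr => a _.
  by rewrite raddfD mulrDr.
- move=> c {}f; rewrite /D (vfM Q _ (@fps_deg_cst _ _ dg c)) vf_cst mul0r add0r podd0 mul1r.
  rewrite mulrBr mulr_sumr; congr (_ - _); apply: eq_bigr => a _.
  rewrite (fps_der_mul _ _ (@fps_deg_cst _ _ dg c)) fps_der_cst mul0r add0r andbF mul1r.
  by rewrite mulrA -fps_cstC -mulrA.
- rewrite /D !fps1E vf_cst big1 ?subr0 // => a _.
  by rewrite fps_der_cst mulr0.
- move=> a {}f; rewrite /D (vfM Q _ (@fps_deg_X K n dg a)) poddN.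
  have -> : \sum_b Q (fps_X K dg b) * fps_der b (fps_X K dg a * f) =
      Q (fps_X K dg a) * f +
      (-1) ^+ podd (dg a) * fps_X K dg a * \sum_b Q (fps_X K dg b) * fps_der b f.
    under eq_bigr do rewrite fps_der_XM mulrDr.
    rewrite big_split /= mulr_sumr; congr (_ + _).
      rewrite (bigD1 a) //= eqxx rmorph1 mul1r big1 ?addr0 // => b /negPf ->.
      by rewrite rmorph0 mul0r mulr0.
    apply: eq_bigr => b _; rewrite fps_signCA.
    rewrite (fps_mulCA _ (vf_deg Q (@fps_deg_X K n dg b)) (@fps_deg_X K n dg a)) fps_signK.
    rewrite -mulrA; congr (_ ^+ nat_of_bool _ * _).
    by rewrite poddD !poddN; case: (podd (dg a)) (podd (dg b)) => [] [].
  by rewrite opprD addrACA subrr add0r mulrBr !mulrA.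
- move=> k {}f hf; apply: fps_vanD.
    by apply: fps_van_le (vf_van Q hf); apply: leq_pred.
  apply: fps_vanN; apply: fps_van_sum => a _; rewrite -[k.-1]add0n.
  by apply: fps_vanM => //; apply: fps_van_der.
Qed.

(** Both sides are derivations along [P] that agree on coordinates, so their difference satisfies
    [D (X_b f) = +- P (X_b) (D f)]. *)
Lemma pb_chain m n (dg' : 'I_m -> int) (dg : 'I_n -> int) (P : fpsmor K dg' dg) a f :
  fps_der a (P f) = \sum_c fps_der a (P (fps_X K dg' c)) * P (fps_der c f).
Proof.
pose D f := fps_der a (P f) - \sum_c fps_der a (P (fps_X K dg' c)) * P (fps_der c f).
have PXd c : fps_deg (- dg' c) (P (fps_X K dg' c)) by apply/pb_deg/fps_deg_X.
have derc (c : K) (g : fps K dg) : fps_der a (fps_cst dg c * g) = fps_cst dg c * fps_der a g.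
  by rewrite (fps_der_mul _ _ (@fps_deg_cst _ _ dg c)) fps_der_cst mul0r add0r andbF mul1r.
apply/eqP; rewrite -subr_eq0; apply/eqP; rewrite -/(D f).
apply: (fps_operator_eq0 (D := D)
  (psi := fun b => (-1) ^+ (podd (dg a) && podd (dg' b)) * P (fps_X K dg' b))) => //.
- move=> {}f g; rewrite /D !raddfD /= addrACA; congr (_ + _).
  rewrite -opprD -big_split /=; congr (- _); apply: eq_bigr => b _.
  by rewrite !raddfD mulrDr.
- move=> c {}f; rewrite /D rmorphM /= pb_cst derc mulrBr mulr_sumr.
  congr (_ - _); apply: eq_bigr => b _.
  rewrite (fps_der_mul _ _ (@fps_deg_cst _ _ dg' c)) fps_der_cst mul0r add0r andbF mul1r.
  by rewrite rmorphM /= pb_cst mulrA -fps_cstC -mulrA.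
- rewrite /D !fps1E pb_cst fps_der_cst big1 ?subr0 // => c _.
  by rewrite fps_der_cst raddf0 mulr0.
- move=> b {}f; rewrite /D rmorphM /= (fps_der_mul _ _ (PXd b)) poddN.
  have -> : \sum_c fps_der a (P (fps_X K dg' c)) * P (fps_der c (fps_X K dg' b * f)) =
      fps_der a (P (fps_X K dg' b)) * P f +
      (-1) ^+ (podd (dg a) && podd (dg' b)) * P (fps_X K dg' b) *
        \sum_c fps_der a (P (fps_X K dg' c)) * P (fps_der c f).
    under eq_bigr do rewrite fps_der_XM raddfD /= mulrDr.
    rewrite big_split /= mulr_sumr; congr (_ + _).
      rewrite (bigD1 b) //= eqxx rmorph1 mul1r big1 ?addr0 // => c /negPf ->.
      by rewrite rmorph0 mul0r raddf0 mulr0.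
    apply: eq_bigr => c _; rewrite rmorphM rmorph_sign rmorphM /= fps_signCA.
    rewrite (fps_mulCA _ (fps_deg_der (a := a) (PXd c)) (PXd b)) fps_signK.
    rewrite -mulrA; congr (_ ^+ nat_of_bool _ * _).
    by rewrite poddD !poddN; case: (podd (dg a)) (podd (dg' c)) (podd (dg' b)) => [] [] [].
  by rewrite opprD addrACA subrr add0r mulrBr !mulrA.
- move=> k {}f hf; apply: fps_vanD; first exact/fps_van_der/pb_van.
  apply: fps_vanN; apply: fps_van_sum => c _; rewrite -[k.-1]add0n.
  by apply: fps_vanM => //; apply/pb_van/fps_van_der.
Qed.

End ChainRules.

Section Supermatrices.
Variables (K : fieldType) (n : nat) (dg : 'I_n -> int) (Q : vfield K dg).
Local Notation A := (fps K dg).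

(** Modelled on Jacobians, where [d_a (P X_c)] has degree [|a| - |c|]; [z] is the degree of the
    matrix as a whole. *)
Definition mxdeg (z : int) k l (dr : 'I_k -> int) (dc : 'I_l -> int)
    (M : 'M[A]_(k, l)) :=
  forall a b, fps_deg (dr a - dc b + z) (M a b).

Definition mxvan (v : nat) k l (M : 'M[A]_(k, l)) := forall a b, fps_van v (M a b).

(* The sign makes [Q] a derivation of the algebra of even matrices. *)
Definition mxvf k l (dr : 'I_k -> int) (M : 'M[A]_(k, l)) : 'M[A]_(k, l) :=
  \matrix_(a, b) ((-1) ^+ podd (dr a) * Q (M a b)).

Definition mxstr k (dr : 'I_k -> int) (M : 'M[A]_k) : A :=
  \sum_a (-1) ^+ podd (dr a) * M a a.

Lemma mxdegM z z' k l r (dr : 'I_k -> int) (dc : 'I_l -> int) (de : 'I_r -> int) M N :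
  mxdeg z dr dc M -> mxdeg z' dc de N -> mxdeg (z + z') dr de (M *m N).
Proof.
move=> hM hN a b; rewrite mxE; apply: fps_deg_sum => c _.
have -> : dr a - de b + (z + z') = (dr a - dc c + z) + (dc c - de b + z') by ring.
exact: fps_degM.
Qed.

Lemma mxdeg1 k (dr : 'I_k -> int) : mxdeg 0 dr dr 1%:M.
Proof.
move=> a b; rewrite mxE; have [->|_] := eqVneq a b; last exact: fps_deg0.
by rewrite subrr addr0 mulr1n; apply: fps_deg_cst.
Qed.

Lemma mxdegB z k l (dr : 'I_k -> int) (dc : 'I_l -> int) M N :
  mxdeg z dr dc M -> mxdeg z dr dc N -> mxdeg z dr dc (M - N).
Proof. by move=> hM hN a b; rewrite !mxE; apply/fps_degD/fps_degN. Qed.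

Lemma mxdeg_vf z k l (dr : 'I_k -> int) (dc : 'I_l -> int) M :
  mxdeg z dr dc M -> mxdeg (z + 1) dr dc (mxvf dr M).
Proof.
by move=> hM a b; rewrite mxE addrA; apply/fps_deg_sign/vf_deg.
Qed.

Lemma mxvanM v v' k l r (M : 'M[A]_(k, l)) (N : 'M[A]_(l, r)) :
  mxvan v M -> mxvan v' N -> mxvan (v + v') (M *m N).
Proof. by move=> hM hN a b; rewrite mxE; apply: fps_van_sum => c _; apply: fps_vanM. Qed.

Lemma mxvf_is_additive k l (dr : 'I_k -> int) :
  zmod_morphism (@mxvf k l dr).
Proof. by move=> M N; apply/matrixP => a b; rewrite !mxE raddfB mulrBr. Qed.
HB.instance Definition _ k l dr :=
  GRing.isZmodMorphism.Build _ _ (@mxvf k l dr) (@mxvf_is_additive k l dr).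

Lemma mxvf_cst k l (dr : 'I_k -> int) (M : 'M[K]_(k, l)) :
  mxvf dr (map_mx (fps_cst dg) M) = 0.
Proof. by apply/matrixP => a b; rewrite !mxE vf_cst mulr0. Qed.

(** In the second term the row sign [(-1)^|a|] and the sign of passing [M a c], of parity
    [|a| + |c|], combine to the row sign [(-1)^|c|] of [mxvf dc N]. *)
Lemma mxvfM k l r (dr : 'I_k -> int) (dc : 'I_l -> int) (M : 'M[A]_(k, l)) (N : 'M_(l, r)) :
  mxdeg 0 dr dc M ->
  mxvf dr (M *m N) = mxvf dr M *m N + M *m mxvf dc N.
Proof.
move=> hM; apply/matrixP => a b; rewrite !mxE raddf_sum mulr_sumr -big_split /=.
apply: eq_bigr => c _; rewrite !mxE (vfM Q _ (hM a c)) mulrDr fps_signK fps_signCA [X in X + _]mulrA.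
congr (_ + (_ ^+ nat_of_bool _) * _).
by rewrite !poddD poddN; case: (podd (dr a)) (podd (dc c)) => [] [].
Qed.

(** The entries [M a b] and [N b a] have degrees [e] and [1 - e]; one of these is even, so the
    entries commute. *)
Lemma mxtrC k l (dr : 'I_k -> int) (dc : 'I_l -> int) (M : 'M[A]_(k, l)) (N : 'M_(l, k)) :
  mxdeg 0 dr dc M -> mxdeg 1 dc dr N -> \tr (M *m N) = \tr (N *m M).
Proof.
move=> hM hN; rewrite /mxtrace.
under eq_bigr do rewrite mxE; under [RHS]eq_bigr do rewrite mxE.
rewrite exchange_big; apply: eq_bigr => b _; apply: eq_bigr => a _.
rewrite (fps_mulC (hM a b) (hN b a)) !poddD !poddN podd1 podd0.
by case: (podd (dr a)) (podd (dc b)) => [] []; rewrite mul1r.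
Qed.

(** The row signs in [mxvf] are those of the supertrace, which thereby becomes an ordinary trace. *)
Lemma vf_str k (dr : 'I_k -> int) (M : 'M[A]_k) : Q (mxstr dr M) = \tr (mxvf dr M).
Proof.
rewrite raddf_sum; apply: eq_bigr => a _; rewrite mxE.
by case: (podd (dr a)); rewrite ?mul1r // !mulN1r raddfN.
Qed.

Lemma mxdegX k (dr : 'I_k -> int) (N : 'M[A]_k) i :
  mxdeg 0 dr dr N -> mxdeg 0 dr dr (N ^+ i).
Proof.
move=> hN; elim: i => [|i IH]; first by rewrite expr0; apply: mxdeg1.
by rewrite exprS -[0]addr0; apply: mxdegM hN IH.
Qed.

Lemma mxvanX k (N : 'M[A]_k) i : mxvan 1 N -> mxvan i (N ^+ i).
Proof.
move=> hN; elim: i => [|i IH]; first by move=> a b; apply: fps_van0.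
by rewrite exprS -add1n; apply: mxvanM hN IH.
Qed.

Lemma mxtr_vfX k (dr : 'I_k -> int) (N : 'M[A]_k) i : mxdeg 0 dr dr N ->
  \tr (mxvf dr (N ^+ i.+1)) = \tr (N ^+ i *m mxvf dr N) *+ i.+1.
Proof.
move=> hN.
(* The left power [N ^+ j] absorbs the factors peeled off [N ^+ i.+1]. As [N] and [Q N] need not
   commute, cyclicity of the trace brings the other factors to the left. *)
suff H j : \tr (N ^+ j *m mxvf dr (N ^+ i.+1)) = \tr (N ^+ (j + i) *m mxvf dr N) *+ i.+1.
  by have := H 0; rewrite expr0 mul1mx.
elim: i j => [|i IH] j; first by rewrite addn0 expr1.
rewrite exprS -[N * _]/(N *m _) (mxvfM _ hN) mulmxDr mxtraceD.
rewrite [N ^+ j *m (N *m _)]mulmxA -[N ^+ j *m N]/(N ^+ j * N) -exprSr IH addSnnS.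
rewrite mulmxA [X in X + _](_ : _ = \tr (N ^+ (j + i.+1) *m mxvf dr N)) -?mulrS //.
have hjN : mxdeg 1 dr dr (N ^+ j *m mxvf dr N).
  rewrite -[1]add0r. apply: mxdegM (mxdegX hN) _.
  by rewrite -[1]add0r; apply: mxdeg_vf.
rewrite -(mxtrC (mxdegX (i := i.+1) hN) hjN) mulmxA -[N ^+ i.+1 *m _]/(_ * _) -exprD.
by rewrite addnC.
Qed.

End Supermatrices.

(** * The divergence of a vector field *)

Section LogStr.
Variables (K : fieldType) (char0 : forall k, k.+1%:R != 0 :> K).
Variables (n : nat) (dg : 'I_n -> int) (Q : vfield K dg).
Variables (l : nat) (dr : 'I_l -> int) (N : 'M[fps K dg]_l).
Hypotheses (Ndeg : mxdeg 0 dr dr N) (Nvan : mxvan 1 N).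
Local Notation A := (fps K dg).

Definition logstr_sum (k : nat) : A :=
  \sum_(i < k) fps_cst dg ((-1) ^+ i / i.+1%:R) * mxstr dr (N ^+ i.+1).

Lemma mxstr_van v (M : 'M[A]_l) : mxvan v M -> fps_van v (mxstr dr M).
Proof. by move=> hM; apply: fps_van_sum => a _; apply: fps_van_sign. Qed.

Lemma mxstr_deg (M : 'M[A]_l) : mxdeg 0 dr dr M -> fps_deg 0 (mxstr dr M).
Proof.
move=> hM; apply: fps_deg_sum => a _; apply: fps_deg_sign.
by have := hM a a; rewrite subrr addr0.
Qed.

(** [N ^+ i.+1] vanishes below arity [i + 1], so the terms with [i >= size w] contribute nothing at
    [w]. *)
Lemma logstr_sum_stable k w : (size w <= k)%N -> logstr_sum k w = logstr_sum (size w) w.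
Proof.
move=> /subnKC <-; rewrite /logstr_sum !fps_sumE big_split_ord /=.
rewrite [X in _ + X]big1 ?addr0 // => i _; apply: (etrans (fps_cstM _ _ _)).
by rewrite (mxstr_van (mxvanX (i := (size w + i).+1) Nvan)) ?mulr0 // ltnS leq_addr.
Qed.

(* [Str (log (1 + N))]: as [N] has no constant part, the partial sums stabilise in
   each arity. *)
Definition logstr : A.
Proof.
exists (fun w => logstr_sum (size w) w) => w1 w2 a b.
by rewrite (fps_sym (logstr_sum _)) !size_cat.
Defined.

Lemma logstr_deg : fps_deg 0 logstr.
Proof.
suff H k : fps_deg 0 (logstr_sum k) by move=> w; apply: H.
by apply: fps_deg_sum => i _; apply/fps_degZ/mxstr_deg/mxdegX.
Qed.

(** The factor [i + 1] from differentiating [N ^+ i.+1] under the trace cancels the denominator of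
    the logarithm, which leaves a truncated geometric series for [(1 + N)^-1]. *)
Lemma vf_logstr_sum k :
  Q (logstr_sum k) = \tr ((\sum_(i < k) (- N) ^+ i) *m mxvf Q dr N).
Proof.
rewrite mulmx_suml [RHS]raddf_sum [LHS]raddf_sum; apply: eq_bigr => i _ /=.
rewrite (vfM Q _ (@fps_deg_cst _ _ dg _)) vf_cst mul0r add0r podd0 mul1r.
rewrite vf_str (mxtr_vfX _ _ Ndeg) -[\tr _ *+ _]mulr_natl mulrA.
rewrite -(rmorph_nat (fps_cst dg)) -rmorphM /= divfK // rmorphXn rmorphN1 /=.
rewrite [(- N) ^+ i]exprNn -[in LHS]signr_odd -[in RHS]signr_odd; case: (odd i); last by rewrite !mul1r.
by rewrite !mulN1r mulNmx raddfN.
Qed.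

(** The geometric sum up to [k] is [V - V (-N)^k]. For [k > size w] neither this remainder nor the
    tail of the logarithm is seen at [w]. *)
Lemma vf_logstr (V : 'M[A]_l) : V *m (1%:M + N) = 1%:M ->
  Q logstr = \tr (V *m mxvf Q dr N).
Proof.
move=> VN; apply: fpsP => w; pose k := (size w).+1.
have -> : Q logstr w = Q (logstr_sum k) w.
  apply/eqP; rewrite -subr_eq0 -fpsBE -raddfB; apply/eqP.
  have /(vf_van Q) : fps_van k (logstr - logstr_sum k); last exact.
  by move=> v vk; rewrite fpsBE logstr_sum_stable ?subrr // ltnW.
rewrite vf_logstr_sum.
have -> : \sum_(i < k) (- N) ^+ i = V - V *m (- N) ^+ k.
  rewrite -[LHS]mul1mx -VN -mulmxA -[X in X - _]mulmx1 -mulmxBr; congr (_ *m _).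
  have := subrX1 (- N) k; rewrite -opprB => /(congr1 -%R); rewrite opprK => ->.
  by rewrite -mulNr opprB opprK.
rewrite mulmxBl [mxtrace _](raddfB (@mxtrace A l)) fpsBE -mulmxA.
suff -> : \tr (V *m ((- N) ^+ k *m mxvf Q dr N)) w = 0 by rewrite subr0.
have NNvan : mxvan 1 (- N).
  by move=> a b; rewrite mxE; apply: fps_vanN.
have : fps_van (0 + (k + 0)) (\tr (V *m ((- N) ^+ k *m mxvf Q dr N))).
  apply: fps_van_sum => a _; apply: mxvanM; first by move=> ? ?; apply: fps_van0.
  by apply: mxvanM; [apply: mxvanX | move=> ? ?; apply: fps_van0].
by apply; rewrite add0n addn0.
Qed.
End LogStr.

Section Divergence.
Variables (K : fieldType) (char0 : forall k, k.+1%:R != 0 :> K).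
Variables (n m : nat) (dE : 'I_n -> int) (dF : 'I_m -> int).
Local Notation A := (fps K dE).
Local Notation B := (fps K dF).

Definition vf_div k (dg : 'I_k -> int) (Q : vfield K dg) : fps K dg :=
  \sum_a fps_der a (Q (fps_X K dg a)).

(** Evaluation at the origin, as a ring endomorphism, so that it carries [J J' = 1] over to the
    constant parts. *)
Definition ev0 (f : A) : A := fps_cst dE (f [::]).

Lemma ev0_is_additive : zmod_morphism ev0.
Proof. by move=> f g; rewrite /ev0 fpsBE raddfB. Qed.
HB.instance Definition _ := GRing.isZmodMorphism.Build A A ev0 ev0_is_additive.
Lemma ev0_is_monoid : monoid_morphism ev0.
Proof. by split=> // f g; rewrite /ev0 fpsME /= rmorphM. Qed.
HB.instance Definition _ := GRing.isMonoidMorphism.Build A A ev0 ev0_is_monoid.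

Lemma ev0_deg x f : fps_deg x f -> fps_deg x (ev0 f).
Proof. by move=> hf [|a w] //=; [apply: hf | rewrite eqxx]. Qed.

Lemma vf_div_pullback (QE : vfield K dE) (QF : vfield K dF)
    (P : fpsmor K dF dE) (P' : fpsmor K dE dF) :
  (forall f, P (QF f) = QE (P f)) ->
  (forall f, P (P' f) = f) -> (forall f, P' (P f) = f) ->
  exists g : A, [/\ g [::] = 0, fps_deg 0 g & vf_div QE - P (vf_div QF) = QE g].
Proof.
move=> PQ PP' P'P.
pose J : 'M[A]_(n, m) := \matrix_(a, c) fps_der a (P (fps_X K dF c)).
pose J' : 'M[A]_(m, n) := \matrix_(c, a) P (fps_der c (P' (fps_X K dE a))).
pose L : 'M[A]_n := \matrix_(a, b) fps_der a (QE (fps_X K dE b)).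
pose M : 'M[A]_m := \matrix_(c, d) P (fps_der c (QF (fps_X K dF d))).
have JJ' : J *m J' = 1%:M.
  apply/matrixP => a b; rewrite mxE.
  under eq_bigr do rewrite !mxE.
  by rewrite -(pb_chain char0) PP' fps_der_X mxE rmorph_nat.
have J'J : J' *m J = 1%:M.
  apply/matrixP => c d; rewrite mxE.
  (* The chain rule is used over [F] and its terms are sent through [P], which undoes [P'] on the
     entries of [J]. *)
  transitivity (P (fps_der c (P' (P (fps_X K dF d))))).
    rewrite (pb_chain char0) raddf_sum; apply: eq_bigr => a _.
    by rewrite !mxE /= rmorphM /= PP'.
  by rewrite P'P fps_der_X pb_cst mxE rmorph_nat.
have Jdeg : mxdeg 0 dE dF J.
  move=> a c; rewrite mxE addr0 addrC; apply: fps_deg_der.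
  exact/pb_deg/fps_deg_X.
have J'deg : mxdeg 0 dF dE J'.
  move=> c a; rewrite mxE addr0 addrC; apply/pb_deg/fps_deg_der.
  exact/pb_deg/fps_deg_X.
have Ldeg : mxdeg 1 dE dE L.
  move=> a b; rewrite mxE -addrA addrC; apply: fps_deg_der; rewrite addrC.
  by rewrite addrC; apply/vf_deg/fps_deg_X.
have JM : J *m M = L *m J + mxvf QE dE J.
  apply/matrixP => a d; rewrite !mxE.
  transitivity (fps_der a (P (QF (fps_X K dF d)))).
    by rewrite (pb_chain char0); apply: eq_bigr => c _; rewrite !mxE.
  (* [QE] is expanded by its chain rule before [d_a] acts. The terms where [d_a] hits [QE X_c] give
     [L J]; in the others [d_a] and [d_c] are swapped, and the chain rule read backwards gives [QE]
     of an entry of [J]. *)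
  rewrite PQ (vf_chain char0 QE (P _)) (vf_chain char0 QE (fps_der a _)).
  rewrite raddf_sum mulr_sumr -big_split; apply: eq_bigr => c _ /=.
  rewrite !mxE (fps_der_mul _ _ (vf_deg QE (@fps_deg_X K n dE c))); congr (_ + _).
  rewrite fps_derC fps_signCA fps_signK; congr (_ ^+ nat_of_bool _ * _).
  by rewrite poddD poddN; case: (podd (dE a)) (podd (dE c)) => [] [].
have trM : \tr M = \tr L + \tr (J' *m mxvf QE dE J).
  rewrite -[M]mul1mx -J'J -mulmxA JM mulmxDr mxtraceD; congr (_ + _).
  have LJdeg : mxdeg 1 dE dF (L *m J) by rewrite -[1]addr0; apply: mxdegM.
  by rewrite (mxtrC J'deg LJdeg) -mulmxA JJ' mulmx1.
pose J0 := map_mx ev0 J; pose J'0 := map_mx ev0 J'.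
have J0J'0 : J0 *m J'0 = 1%:M by rewrite -map_mxM JJ' map_mx1.
have J'0J0 : J'0 *m J0 = 1%:M by rewrite -map_mxM J'J map_mx1.
have J0deg : mxdeg 0 dE dF J0 by move=> a c; rewrite mxE; apply: ev0_deg.
have J'0deg : mxdeg 0 dF dE J'0 by move=> a c; rewrite mxE; apply: ev0_deg.
(* The inverse [J'0] of the constant part turns [J], whose rows and columns belong to [E] and [F],
   into a square matrix [1 + N] equal to 1 at the origin; [V] is its inverse. *)
pose N := J *m J'0 - 1%:M; pose V := J0 *m J'.
have Ndeg : mxdeg 0 dE dE N.
  by apply: mxdegB (@mxdeg1 _ _ _ _ _); rewrite -[0]addr0; apply: mxdegM.
have Nvan : mxvan 1 N.
  move=> a b [|? ?] // _.
  have /(congr1 (fun X : 'M_n => X a b)) : map_mx ev0 N = 0.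
    rewrite map_mxB map_mxM map_mx1 -/J0 (_ : map_mx ev0 J'0 = J'0) ?J0J'0 ?subrr //.
    by apply/matrixP => c d; rewrite !mxE.
  by rewrite !mxE => /(congr1 (fun f : A => f [::])); rewrite fps0E.
have VN : V *m (1%:M + N) = 1%:M.
  by rewrite addrCA subrr addr0 mulmxA -[V *m J]mulmxA J'J mulmx1.
(* The constant factors are killed by [QE] and cancel by cyclicity, so the normalisation does not
   change the trace. *)
have trV : \tr (V *m mxvf QE dE N) = \tr (J' *m mxvf QE dE J).
  have -> : mxvf QE dE N = mxvf QE dE J *m J'0.
    rewrite raddfB /= (mxvfM QE _ Jdeg).
    have -> : mxvf QE dF J'0 = 0.
      by apply/matrixP => c a; rewrite !mxE vf_cst mulr0.
    rewrite mulmx0 addr0 -(map_mx1 (fps_cst dE)) mxvf_cst subr0 //.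
  have JQdeg : mxdeg 1 dF dE (J' *m (mxvf QE dE J *m J'0)).
    rewrite -[1]add0r; apply: mxdegM J'deg _.
    by rewrite -[1]addr0; apply: mxdegM J'0deg; rewrite -[1]add0r; apply: mxdeg_vf.
  rewrite /V -mulmxA (mxtrC J0deg JQdeg) !mulmxA -[_ *m J'0 *m J0]mulmxA J'0J0.
  by rewrite mulmx1.
(* The minus sign comes from [tr L - tr M = - tr (J' (QE J))]. *)
exists (- logstr dE N); split.
- by rewrite fpsNE /= /logstr_sum big_ord0 fps0E oppr0.
- exact/fps_degN/logstr_deg.
- rewrite raddfN /= (vf_logstr char0 QE Ndeg Nvan VN) trV.
  have -> : vf_div QE = \tr L by apply: eq_bigr => a _; rewrite mxE.
  have -> : P (vf_div QF) = \tr M.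
    by rewrite raddf_sum; apply: eq_bigr => a _; rewrite mxE.
  by rewrite trM opprD addrA subrr add0r.
Qed.

End Divergence.

(** * Homogeneous bases *)

Section HomogeneousBasis.
Variables (K : fieldType) (E : gradedSpace K).
Local Notation S := (seq_sub (gdegs E)).
Local Notation part i := (gpart E (val i)).

Definition hindex := {i : S & 'I_(\dim (part i))}.
Definition hdim : nat := #|{: hindex}|.
Definition hidx (a : 'I_hdim) : hindex := enum_val a.
Definition hdeg (a : 'I_hdim) : int := val (tag (hidx a)).
Definition hvec (a : 'I_hdim) : E := (vbasis (part (tag (hidx a))))`_(tagged (hidx a)).
Definition hcoord (a : 'I_hdim) (v : E) : K :=
  coord (vbasis (part (tag (hidx a)))) (tagged (hidx a)) (gproj (tag (hidx a)) v).

Lemma hcoordP a c u v : hcoord a (c *: u + v) = c * hcoord a u + hcoord a v.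
Proof. by rewrite /hcoord linearP linearP. Qed.

Lemma gproj_mem (i : S) v : gproj i v \in part i.
Proof. exact: memv_sum_pi. Qed.

Lemma gproj_sum v : \sum_(i : S) gproj i v = v.
Proof. by apply: sumv_pi_sum; rewrite memvf. Qed.

Lemma gproj_homog (i j : S) v : v \in part j -> gproj i v = if i == j then v else 0.
Proof.
move=> vj.
have := gpart_direct E => /directv_sum_unique H.
pose u (k : S) : E := if k == j then v else 0.
have uP k : true -> u k \in part k.
  by move=> _; rewrite /u; case: eqP => [->|_] //; rewrite mem0v.
have := H (fun k => gproj k v) u (fun k _ => gproj_mem k v) uP.
rewrite gproj_sum /u -big_mkcond big_pred1_eq eqxx => /esym/forallP/(_ i)/implyP/(_ isT)/eqP.
by [].
Qed.

Lemma hidx_sum (V : nmodType) (F : hindex -> V) :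
  \sum_(a < hdim) F (hidx a) = \sum_(i : S) \sum_(j < \dim (part i)) F (existT _ i j).
Proof.
rewrite (sig_big_dep (J := fun i : S => 'I_(\dim (part i)) : finType) xpredT
  (fun=> xpredT) (fun (i : S) j => F (existT _ i j))) /=.
by rewrite -(big_enum_val (A := predT) F); apply: eq_big => [[? ?]|[? ?]].
Qed.

Lemma hcoord_sum_part (i : S) v :
  gproj i v = \sum_(j < \dim (part i)) coord (vbasis (part i)) j (gproj i v) *:
     (vbasis (part i))`_j.
Proof. by rewrite -coord_vbasis ?gproj_mem. Qed.

Lemma hcoord_sum v : v = \sum_a hcoord a v *: hvec a.
Proof.
rewrite (hidx_sum (fun s => coord (vbasis (part (tag s))) (tagged s) (gproj (tag s) v)
   *: (vbasis (part (tag s)))`_(tagged s))) /=.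
by rewrite -[LHS]gproj_sum; apply: eq_bigr => i _; apply: hcoord_sum_part.
Qed.

Lemma hvec_mem a : hvec a \in gpart E (hdeg a).
Proof. by apply: vbasis_mem; rewrite mem_nth // size_tuple. Qed.

Lemma hcoord_hvec a b : hcoord a (hvec b) = (a == b)%:R.
Proof.
rewrite /hcoord (gproj_homog _ (hvec_mem b)); case: (eqVneq a b) => [->|ab].
  by rewrite eqxx coord_free ?eqxx // (basis_free (vbasisP _)).
case: eqP => [E1|_]; last by rewrite linear0.
have : hidx a != hidx b by rewrite (inj_eq enum_val_inj).
rewrite /hvec; move: E1; case: (hidx a) (hidx b) => [i j] [i' j'] /= E1.
rewrite -{i'}E1 in j' *; move=> H.
rewrite coord_free ?(basis_free (vbasisP _)) //.
by case: eqP => // jj'; move: H; rewrite jj' eqxx.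
Qed.

Lemma hcoord_homog a i v : v \in gpart E i -> hcoord a v != 0 -> hdeg a = i.
Proof.
move=> vi; case: (boolP (i \in gdegs E)) => [iE|/gpart_eq0 Ei]; last first.
  by move: vi; rewrite Ei memv0 => /eqP ->; rewrite /hcoord !linear0 eqxx.
rewrite /hcoord (@gproj_homog _ (SeqSub iE)) //.
by case: ifP => [/eqP e _|_]; [rewrite /hdeg e | rewrite linear0 eqxx].
Qed.

Lemma supertraceE (phi : E -> E) :
  supertrace phi = \sum_a (-1) ^+ podd (hdeg a) * hcoord a (phi (hvec a)).
Proof.
rewrite (hidx_sum (fun s => (-1) ^+ podd (val (tag s)) *
  coord (vbasis (part (tag s))) (tagged s)
    (gproj (tag s) (phi (vbasis (part (tag s)))`_(tagged s))))) /=.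
by apply: eq_bigr => i _; rewrite mulr_sumr exprz_podd.
Qed.

End HomogeneousBasis.

(** * Functions as formal power series *)

(* Linearity in the vector component of each letter. *)
Definition wlin (K : fieldType) (E : lmodType K) (G : seq (int * E) -> K) :=
  forall s t d a x y, G (s ++ (d, a *: x + y) :: t) =
    a * G (s ++ (d, x) :: t) + G (s ++ (d, y) :: t).

Section WLin.
Variables (K : fieldType) (E : lmodType K).
Local Notation T := (int * E)%type.
Local Notation p := (fun t : T => podd t.1).

Lemma wlin_der t (G : seq T -> K) : wlin G -> wlin (wder t G).
Proof. by move=> hG s; apply: (hG (t :: s)). Qed.

Lemma wlin_sgn q (G : seq T -> K) : wlin G -> wlin (wsgn p q G).
Proof.
move=> hG s t d a x y; rewrite /wsgn hG mulrDr !wpar_cat /=.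
by congr (_ + _); rewrite mulrCA.
Qed.

Lemma wlin_mul (G H : seq T -> K) : wlin G -> wlin H -> wlin (wmul p G H).
Proof.
move=> hG hH s; elim: s G H hG hH => [|u s IH] G H hG hH t d a x y /=; last first.
  rewrite (IH _ _ (wlin_der u hG) hH) (IH _ _ (wlin_sgn _ hG) (wlin_der u hH)).
  by rewrite mulrDr addrACA.
have dE (F : seq T -> K) : wlin F ->
    wder (d, a *: x + y) F = (a \*o wder (d, x) F) \+ wder (d, y) F.
  by move=> hF; apply: funext => w; apply: (hF [::]).
rewrite !dE // wmulDl wmulDr wmulZl wmulZr /=.
by rewrite mulrDr addrACA.
Qed.

Lemma wlin_rev (G : seq T -> K) : wlin G -> wlin (G \o rev).
Proof.
move=> hG s t d a x y /=; rewrite !rev_cat !rev_cons -!cats1 -!catA; exact: hG.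
Qed.
End WLin.

Section Extension.
Variables (K : fieldType) (E : gradedSpace K).
Local Notation n := (hdim E).
Local Notation dg := (@hdeg K E).
Local Notation p := (podd \o dg).
Local Notation S := (seq_sub (gdegs E)).

Definition multilin (f : seq E -> K) := forall s t a x y,
  f (s ++ (a *: x + y) :: t) = a * f (s ++ x :: t) + f (s ++ y :: t).

Definition gsym (f : seq E -> K) := forall s t i j x y,
  x \in gpart E i -> y \in gpart E j ->
  f (s ++ x :: y :: t) = (-1) ^ (i * j) * f (s ++ y :: x :: t).

(** Multilinear extension from basis words, read in the order of the arguments and not backwards as
    in [wmul]. *)
Fixpoint mext (h : seq 'I_n -> K) (x : seq E) : K :=
  if x is v :: x' then \sum_a hcoord a v * mext (wder a h) x' else h [::].

Lemma mext_lin c h h' x :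
  mext (fun w => c * h w + h' w) x = c * mext h x + mext h' x.
Proof.
elim: x h h' => [|v x IH] h h' //=; rewrite mulr_sumr -big_split; apply: eq_bigr => a _ /=.
rewrite -[wder a _]/(fun w => c * wder a h w + wder a h' w) IH.
by rewrite mulrDr mulrCA.
Qed.

Lemma mext0 x : mext (fun=> 0) x = 0.
Proof.
by elim: x => //= v x IH; apply: big1 => a _; rewrite -[wder a _]/(fun=> 0) IH mulr0.
Qed.

Lemma mextZ c h x : mext (fun w => c * h w) x = c * mext h x.
Proof.
have := mext_lin c h (fun=> 0) x; rewrite mext0 addr0 => <-.
by congr mext; apply: funext => w; rewrite addr0.
Qed.

Lemma mext_sum (I : finType) (P : pred I) (F : I -> seq 'I_n -> K) x :
  mext (fun w => \sum_(i | P i) F i w) x = \sum_(i | P i) mext (F i) x.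
Proof.
elim: x F => [|v x IH] F //=; rewrite exchange_big; apply: eq_bigr => a _ /=.
by rewrite -[wder a _]/(fun w => \sum_(i | P i) wder a (F i) w) IH mulr_sumr.
Qed.

Lemma mext_multilin h : multilin (mext h).
Proof.
move=> s; elim: s h => [|v s IH] h t a x y /=; rewrite mulr_sumr -big_split.
  by apply: eq_bigr => b _ /=; rewrite hcoordP mulrDl mulrA.
by apply: eq_bigr => b _ /=; rewrite IH mulrDr mulrCA.
Qed.

Lemma multilin_sum f s t (I : finType) (P : pred I) (c : I -> K) (u : I -> E) :
  multilin f ->
  f (s ++ (\sum_(i | P i) c i *: u i) :: t) = \sum_(i | P i) c i * f (s ++ u i :: t).
Proof.
move=> hf; elim/big_rec2: _ => [|i y1 y2 _ <-]; last exact: hf.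
by have := hf s t (-1) 0 0; rewrite scaler0 addr0 mulN1r addNr.
Qed.

Lemma mext_hvec h w : mext h (map (@hvec K E) w) = h w.
Proof.
elim: w h => //= a w IH h; rewrite (bigD1 a) //= hcoord_hvec eqxx mul1r IH.
by rewrite big1 ?addr0 // => b /negPf ba; rewrite hcoord_hvec ba mul0r.
Qed.

Lemma mext_map f x : multilin f -> mext (f \o map (@hvec K E)) x = f x.
Proof.
elim: x f => [|v x IH] f hf //=.
rewrite {2}(hcoord_sum v) (multilin_sum [::] x _ _ _ hf) /=.
apply: eq_bigr => a _; congr (_ * _).
by rewrite -(IH (fun x => f (hvec a :: x))) // => s; apply: (hf (hvec a :: s)).
Qed.

(** Only basis vectors of degrees [i] and [j] occur in [x] and [y], so every term of the expansion
    is exchanged with the same sign. *)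
Lemma mext_gsym h : wsym p h -> gsym (mext h).
Proof.
move=> hh s; elim: s h hh => [|v s IH] h hh t i j x y xi yj /=; last first.
  rewrite mulr_sumr; apply: eq_bigr => a _.
  by rewrite (IH _ (wsym_der a hh) _ _ _ _ _ xi yj) mulrCA.
rewrite mulr_sumr; under eq_bigr do rewrite mulr_sumr.
under [RHS]eq_bigr do rewrite !mulr_sumr.
rewrite [RHS]exchange_big; apply: eq_bigr => a _; apply: eq_bigr => b _ /=.
have [->|xa] := eqVneq (hcoord a x) 0; first by rewrite !(mul0r, mulr0).
have [->|yb] := eqVneq (hcoord b y) 0; first by rewrite !(mul0r, mulr0).
rewrite (wsymP hh) /= (hcoord_homog xi xa) (hcoord_homog yj yb).
by rewrite mextZ exprz_podd poddM; ring.
Qed.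

Lemma mext_deg h d x : homog d x -> mext h x != 0 ->
  exists2 w, h w != 0 & map dg w = d.
Proof.
elim: x d h => [|v x IH] [|i d] h //=; first by move=> _ h0; exists [::].
move=> /andP[vi dx].
have [/existsP[a /andP[va]] /(IH _ _ dx)[w hw <-] _|] :=
    boolP [exists a, (hcoord a v != 0) && (mext (wder a h) x != 0)].
  by exists (a :: w) => //=; rewrite (hcoord_homog vi va).
rewrite negb_exists => /forallP none; rewrite big1 ?eqxx // => a _.
by have := none a; rewrite negb_and !negbK => /orP[]/eqP ->; rewrite ?mul0r ?mulr0.
Qed.

Lemma mext_eq0 h x : (forall w, size w = size x -> h w = 0) -> mext h x = 0.
Proof.
elim: x h => [|v x IH] h hh /=; first exact: hh.
by apply: big1 => a _; rewrite IH ?mulr0 // => w hw; apply: hh; rewrite /= hw.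
Qed.

Lemma mext_rcons h x a :
  mext h (rcons x (hvec a)) = mext (fun w => h (rcons w a)) x.
Proof.
elim: x h => [|v x IH] h /=; last by apply: eq_bigr => b _; rewrite IH.
rewrite (bigD1 a) //= hcoord_hvec eqxx mul1r.
by rewrite big1 ?addr0 // => b /negPf ba; rewrite hcoord_hvec ba mul0r.
Qed.

Lemma sum_tuple_cons k (G : seq S -> K) :
  \sum_(d : k.+1.-tuple S) G d = \sum_(i : S) \sum_(d : k.-tuple S) G (i :: d).
Proof.
rewrite pair_bigA /= (reindex (fun q : S * k.-tuple S => cons_tuple q.1 q.2)) //.
exists (fun d : k.+1.-tuple S => (thead d, behead_tuple d)) => [[i d] _|d _] /=.
  by congr (_, _); apply: val_inj.
by rewrite [d in RHS]tuple_eta; apply: val_inj.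
Qed.

Definition hletter (a : 'I_n) : int * E := (dg a, hvec a).

(** Splitting into homogeneous components and expanding each in its basis amounts to expanding in
    the homogeneous basis, each letter keeping its degree. *)
Lemma sum_gproj (G : seq (int * E) -> K) x : wlin G ->
  \sum_(d : (size x).-tuple S)
     G (zip (map val d) [seq gproj iv.1 iv.2 | iv <- zip d x]) =
  mext (G \o map hletter) x.
Proof.
elim: x G => [|v x IH] G hG /=.
  rewrite (bigD1 [tuple]) //= big1 ?addr0 // => d /eqP[].
  exact: tuple0.
rewrite (@sum_tuple_cons (size x) (fun d =>
  G (zip (map val d) [seq gproj iv.1 iv.2 | iv <- zip d (v :: x)]))) /=.
transitivity (\sum_(i : S) \sum_(j < \dim (gpart E (val i)))
    coord (vbasis (gpart E (val i))) j (gproj i v) *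
    mext (fun w => G ((val i, (vbasis (gpart E (val i)))`_j) :: map hletter w)) x).
  apply: eq_bigr => i _; rewrite (IH (fun w => G ((val i, gproj i v) :: w))); last first.
    by move=> s; apply: (hG (_ :: s)).
  transitivity (mext (fun w => \sum_(j < \dim (gpart E (val i)))
      coord (vbasis (gpart E (val i))) j (gproj i v) *
      G ((val i, (vbasis (gpart E (val i)))`_j) :: map hletter w)) x).
    congr mext; apply: funext => w /=; rewrite {1}hcoord_sum_part.
    elim/big_rec2: _ => [|j y1 y2 _ <-]; last exact: (hG [::]).
    by have := hG [::] (map hletter w) (val i) (-1) 0 0; rewrite scaler0 addr0 mulN1r addNr.
  by rewrite mext_sum; apply: eq_bigr => j _; rewrite mextZ.
by rewrite -(hidx_sum (fun s => coord (vbasis (gpart E (val (tag s)))) (tagged s)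
  (gproj (tag s) v) * mext (fun w => G ((val (tag s),
    (vbasis (gpart E (val (tag s))))`_(tagged s)) :: map hletter w)) x)).
Qed.

(** Pairing each argument with its degree makes both permute together, so that [shuffle_sum]
    applies. *)
Lemma fmul_homogE (f g : seq E -> K) d x : size d = size x ->
  fmul_homog f g d x =
  wmul (fun t : int * E => podd t.1) (f \o map snd \o rev) (g \o map snd \o rev)
    (rev (zip d x)).
Proof.
move=> sdx; set k := size x; have szz : size (zip d x) = k by rewrite size_zip sdx minnn.
pose z (a : 'I_k) := nth (0, 0 : gcarrier E) (zip d x) a.
have zE : [seq z a | a <- enum 'I_k] = zip d x.
  transitivity (map (nth (0, 0 : gcarrier E) (zip d x)) (map val (enum 'I_k))).
    by rewrite -map_comp.
  by rewrite val_enum_ord map_nth_iota0 ?szz // -szz take_size.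
have -> : zip d x = [seq z a | a <- enum 'I_k] by [].
have := shuffle_sum (@fst int E) z (f \o map snd) (g \o map snd).
rewrite -[podd \o fst]/(fun t : int * E => podd t.1) => <-.
apply: eq_bigr => i _; apply: eq_bigr => s _.
have px : permseq 0 s x = map snd (iword z s).
  rewrite /permseq /iword -map_comp; apply: eq_map => a /=.
  by rewrite /z nth_zip.
have pd : permseq 0 s d = map fst (iword z s).
  rewrite /permseq /iword -map_comp; apply: eq_map => a /=.
  by rewrite /z nth_zip.
rewrite /shterm px pd !exprz_podd !map_take !map_drop /=; congr (_ * _ * _).
by apply: eq_bigr => q _; rewrite exprz_podd /= /z !nth_zip.
by rewrite !map_take !map_drop.
Qed.

(** The reversal matches the backward reading of words in [wmul]. *)
Definition coeffs (f : seq E -> K) : seq 'I_n -> K := fun w => f (map (@hvec K E) (rev w)).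

Lemma fmulE (f g : seq E -> K) : multilin f -> multilin g ->
  fmul f g = mext (wmul p (coeffs f) (coeffs g) \o rev).
Proof.
move=> hf hg; apply: funext => x; rewrite /fmul.
pose F := f \o map (@snd int E) \o rev; pose G := g \o map (@snd int E) \o rev.
have hF : wlin F.
  by apply: (@wlin_rev _ _ (f \o _)) => s t d a u v /=; rewrite !map_cat /=; apply: hf.
have hG : wlin G.
  by apply: (@wlin_rev _ _ (g \o _)) => s t d a u v /=; rewrite !map_cat /=; apply: hg.
transitivity (\sum_(d : (size x).-tuple S)
   (wmul (fun t : int * E => podd t.1) F G \o rev)
     (zip (map val d) [seq gproj iv.1 iv.2 | iv <- zip d x])).
  apply: eq_bigr => d _; rewrite fmul_homogE // !size_map size_zip size_tuple.
  by rewrite minnn.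
rewrite sum_gproj; last exact/wlin_rev/wlin_mul.
congr mext; apply: funext => w /=; rewrite -map_rev.
rewrite -[LHS]/((wmul _ F G \o map hletter) (rev w)).
rewrite -(@wmul_map _ _ _ p) //; congr (wmul p _ _ _); apply: funext => v.
  by rewrite /F /coeffs /= -map_rev -map_comp.
by rewrite /G /coeffs /= -map_rev -map_comp.
Qed.

End Extension.

(** * Transport of derivations and morphisms *)

Lemma sumz_rev d : sumz (rev d) = sumz d.
Proof. by apply: perm_big; rewrite perm_rev. Qed.

Section Functions.
Variables (K : fieldType) (E : gradedSpace K).
Local Notation dg := (@hdeg K E).
Local Notation A := (fps K dg).

Implicit Types f g : A.

Definition toseq (f : A) : seq E -> K := mext (fpsval f \o rev).

Lemma coeffs_sym (g : seq E -> K) : gsym g -> wsym (podd \o dg) (coeffs g).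
Proof.
move=> hg w1 w2 a b; rewrite /coeffs !rev_cat !rev_cons -!cats1 -!catA !map_cat /=.
by rewrite (hg _ _ _ _ _ _ (hvec_mem b) (hvec_mem a)) exprz_podd poddM andbC.
Qed.

Lemma toseq_gsym f : gsym (toseq f).
Proof.
apply: mext_gsym => w1 w2 a b /=; rewrite !rev_cat !rev_cons -!cats1 -!catA /=.
by rewrite (fps_sym f) andbC.
Qed.

Lemma toseq_fun (f : A) : f [::] = 0 -> is_function (toseq f).
Proof. by move=> f0; split; [apply: f0 | apply: mext_multilin | apply: toseq_gsym]. Qed.

Lemma coeffs_toseq f : coeffs (toseq f) = f.
Proof. by apply: funext => w; rewrite /coeffs /toseq mext_hvec /= revK. Qed.

Lemma toseq_coeffs (g : seq E -> K) : multilin g -> mext (coeffs g \o rev) = g.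
Proof.
move=> hg; apply: funext => x; rewrite -[RHS](mext_map _ hg).
by congr mext; apply: funext => w; rewrite /coeffs /= revK.
Qed.

Lemma toseq_lin c f g :
  toseq (fps_cst dg c * f + g) = fun x => c * toseq f x + toseq g x.
Proof.
apply: funext => x; rewrite -mext_lin; congr mext; apply: funext => w.
by apply: (etrans (fpsDE _ _ _)); rewrite fps_cstM.
Qed.

Lemma toseqB f g x : toseq (f - g) x = toseq f x - toseq g x.
Proof.
have -> : f - g = fps_cst dg (-1) * g + f by rewrite rmorphN1 mulN1r addrC.
by rewrite toseq_lin mulN1r addrC.
Qed.

Lemma toseqM f g : fmul (toseq f) (toseq g) = toseq (f * g).
Proof. by rewrite fmulE ?coeffs_toseq //; apply: mext_multilin. Qed.

Lemma toseq_deg x f : fps_deg x f -> function_degree x (toseq f).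
Proof.
move=> hf d y dy /(mext_deg dy)[w /hf <- <-].
by rewrite -[in LHS](revK w) map_rev sumz_rev.
Qed.

Lemma coeffs_deg x (g : seq E -> K) w : function_degree x g ->
  coeffs g w != 0 -> sumz (map dg w) = - x.
Proof.
move=> hg nz; rewrite -(hg (map dg (rev w)) _ _ nz) ?map_rev ?sumz_rev //.
by rewrite -!map_rev; elim: (rev w) => //= a v ->; rewrite hvec_mem.
Qed.

Lemma toseq_van k f x : fps_van k f -> (size x < k)%N -> toseq f x = 0.
Proof. by move=> hf xk; apply: mext_eq0 => w wx; apply: hf; rewrite size_rev wx. Qed.

(** The operators of the statement are constrained only on functions that vanish at the empty
    sequence, so the constant term is removed before they are applied. *)
Definition noconst f : A := f - fps_cst dg (f [::]).

Lemma noconst_nil f : noconst f [::] = 0.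
Proof. by rewrite fpsBE subrr. Qed.

Lemma noconst_id f : f [::] = 0 -> noconst f = f.
Proof. by move=> f0; rewrite /noconst f0 rmorph0 subr0. Qed.

Lemma noconst_cst c : noconst (fps_cst dg c) = 0.
Proof. exact: subrr. Qed.

Lemma noconst_lin c f g : noconst (fps_cst dg c * f + g) =
  fps_cst dg c * noconst f + noconst g.
Proof.
rewrite /noconst fpsDE fps_cstM rmorphD rmorphM /=.
by rewrite mulrBr opprD addrACA.
Qed.

Lemma noconst_deg x f : fps_deg x f -> fps_deg x (noconst f).
Proof.
move=> hf [|a w]; rewrite fpsBE /= ?subrr ?eqxx //.
by rewrite subr0; apply: hf.
Qed.

Lemma noconst_van k f : fps_van k f -> fps_van k (noconst f).
Proof.
move=> hf [|a w] hw; rewrite fpsBE /= ?subrr //.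
by rewrite subr0; apply: hf.
Qed.
End Functions.

Section Lift.
Variables (K : fieldType) (E F : gradedSpace K).
Variables (p : int) (D : (seq E -> K) -> (seq F -> K)).
Hypothesis hD : function_operator p D.
Local Notation A := (fps K (@hdeg K E)).
Local Notation B := (fps K (@hdeg K F)).
Implicit Types f g : A.

Let Dfun h : is_function h -> is_function (D h). Proof. by case: hD => H _ _ _; apply: H. Qed.

(** Constants are killed, as befits a derivation; for algebra morphisms [lift_mor] puts them
    back. *)
Definition lift_op f : B :=
  Fps (coeffs (D (toseq (noconst f))))
    (let: And3 _ _ hs := Dfun (toseq_fun (noconst_nil f)) in coeffs_sym hs).

Lemma lift_op_nil f : lift_op f [::] = 0.
Proof. by case: (Dfun (toseq_fun (noconst_nil f))). Qed.

Lemma lift_op_lin c f g : lift_op (fps_cst _ c * f + g) =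
  fps_cst _ c * lift_op f + lift_op g.
Proof.
apply: fpsP => w; rewrite fpsDE fps_cstM /= /coeffs noconst_lin toseq_lin.
by case: hD => _ H _ _; rewrite H //; apply/toseq_fun/noconst_nil.
Qed.

Lemma lift_op_is_additive : zmod_morphism lift_op.
Proof.
move=> f g; have := lift_op_lin (-1) g f.
by rewrite !rmorphN1 !mulN1r ![- _ + _]addrC.
Qed.

Lemma lift_op_cst c : lift_op (fps_cst _ c) = 0.
Proof.
have -> : lift_op (fps_cst _ c) = lift_op 0.
  by apply: fpsP => w /=; rewrite noconst_cst (noconst_id (fps0E _ _ _)).
by rewrite -(subrr 0) lift_op_is_additive subrr.
Qed.

Lemma lift_opZ c f : lift_op (fps_cst _ c * f) = fps_cst _ c * lift_op f.
Proof. by have := lift_op_lin c f (fps_cst _ 0); rewrite lift_op_cst raddf0 !addr0. Qed.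

Lemma lift_opD f g : lift_op (f + g) = lift_op f + lift_op g.
Proof. by have := lift_op_lin 1 f g; rewrite !rmorph1 !mul1r. Qed.

Lemma lift_op_noconst f : lift_op (noconst f) = lift_op f.
Proof. by rewrite lift_op_is_additive lift_op_cst subr0. Qed.

Lemma lift_op_deg x f : fps_deg x f -> fps_deg (x + p) (lift_op f).
Proof.
move=> hf w; apply: coeffs_deg; case: hD => _ _ H _.
by apply: H; [apply/toseq_fun/noconst_nil | apply/toseq_deg/noconst_deg].
Qed.

Lemma op_zero x : D (fun=> 0) x = 0.
Proof.
have h0 : is_function (fun _ : seq E => 0 : K).
  by split=> // *; rewrite ?mulr0 ?addr0 //; rewrite /GRing.scale /= mulr0 ?addr0.
case: hD => _ H _ _; have := H (-1) _ _ h0 h0 x.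
by rewrite mulr0 addr0 => ->; rewrite mulN1r addNr.
Qed.

Lemma lift_op_van k f : fps_van k f -> fps_van k (lift_op f).
Proof.
(* Vanishing below arity [k + 1] is agreement with the zero function up to arity [k], which the last
   clause of [function_operator] transports. *)
case: k => [|k] // hf w wk; rewrite -[LHS]/(D _ _).
case: hD => _ _ _ H.
rewrite (H k _ (fun=> 0)) ?op_zero ?size_map ?size_rev //.
- exact/toseq_fun/noconst_nil.
- by split=> // *; rewrite /GRing.scale /= mulr0 ?addr0.
- by move=> y yk; apply: (toseq_van (noconst_van hf)).
Qed.

Lemma toseq_lift_op f : f [::] = 0 -> toseq (lift_op f) = D (toseq f).
Proof.
move=> f0; case: (Dfun (toseq_fun f0)) => _ hl _.
by rewrite -[RHS](toseq_coeffs hl) /toseq /= (noconst_id f0).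
Qed.

End Lift.


(** The rules for [fmul] concern factors without constant term; this isolates the part of a product
    to which they apply. *)
Lemma split_mul (K : fieldType) (E : gradedSpace K) (f g : fps K (@hdeg K E)) :
  f * g = noconst f * noconst g + fps_cst _ (f [::]) * noconst g +
    fps_cst _ (g [::]) * noconst f + fps_cst _ (f [::] * g [::]).
Proof.
have nE (h : fps K (@hdeg K E)) : h = noconst h + fps_cst _ (h [::]) by rewrite subrK.
move: (noconst f) (noconst g) (nE f) (nE g) => f0 g0 fE gE.
rewrite {1}fE {1}gE mulrDl !mulrDr -[f0 * fps_cst _ _]fps_cstC.
by rewrite -rmorphM addrA [X in X + _ = _]addrAC.
Qed.

Section LiftDerivation.
Variables (K : fieldType) (E : gradedSpace K) (Q : (seq E -> K) -> (seq E -> K)).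
Hypothesis hQ : derivation 1 Q.
Local Notation dg := (@hdeg K E).
Local Notation A := (fps K dg).
Implicit Types f g : A.
Let Qh := lift_op (proj1 hQ).

Lemma lift_der_mul0 x f g : f [::] = 0 -> g [::] = 0 -> fps_deg x f ->
  Qh (f * g) = Qh f * g + (-1) ^+ podd x * (f * Qh g).
Proof.
move=> f0 g0 hf.
have fg0 : (f * g) [::] = 0 by rewrite fpsME /= f0 mul0r.
apply: fpsP => w; rewrite fpsDE fps_signE -(coeffs_toseq (Qh (f * g))).
rewrite /Qh toseq_lift_op // -toseqM /coeffs.
have [_ H] := hQ; rewrite (H x _ _ (toseq_fun f0) (toseq_deg hf) (toseq_fun g0)).
rewrite -(toseq_lift_op (proj1 hQ) f0) -(toseq_lift_op (proj1 hQ) g0) !toseqM.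
by rewrite -!/(coeffs _ _) !coeffs_toseq mul1r exprz_podd.
Qed.

Lemma lift_derM x f g : fps_deg x f ->
  Qh (f * g) = Qh f * g + (-1) ^+ podd x * (f * Qh g).
Proof.
move=> hf; rewrite split_mul /Qh !lift_opD lift_op_cst addr0 -/Qh.
rewrite (lift_der_mul0 (noconst_nil f) (noconst_nil g) (noconst_deg hf)).
rewrite /Qh !lift_opZ !lift_op_noconst -/Qh.
(* A nonzero constant term forces [x = 0], and then the sign is trivial. *)
have sE : (-1) ^+ podd x * (fps_cst dg (f [::]) * Qh g) = fps_cst dg (f [::]) * Qh g.
  have [->|/hf] := eqVneq (f [::]) 0; first by rewrite rmorph0 !(mul0r, mulr0).
  by rewrite /sumz big_nil => /eqP; rewrite eq_sym oppr_eq0 => /eqP ->; rewrite mul1r.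
have -> : Qh f * g = Qh f * noconst g + fps_cst dg (g [::]) * Qh f.
  by rewrite fps_cstC -mulrDr subrK.
have -> : (-1) ^+ podd x * (f * Qh g) =
    (-1) ^+ podd x * (noconst f * Qh g) + fps_cst dg (f [::]) * Qh g.
  by rewrite -sE -mulrDr -mulrDl subrK.
by rewrite -!addrA; congr (_ + _); rewrite [RHS]addrC -addrA.
Qed.

Definition lift_vfield : vfield K dg :=
  VField (lift_op_is_additive _) (lift_op_cst _) lift_derM
    (@lift_op_deg _ _ _ _ _ (proj1 hQ)) (@lift_op_van _ _ _ _ _ (proj1 hQ)).
End LiftDerivation.

Section LiftMorphism.
Variables (K : fieldType) (E F : gradedSpace K) (P : (seq F -> K) -> (seq E -> K)).
Hypothesis hP : algebra_morphism P.
Local Notation A := (fps K (@hdeg K E)).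
Local Notation B := (fps K (@hdeg K F)).
Implicit Types f g : B.
Let P0 := lift_op (proj1 hP).

Definition lift_mor f : A := fps_cst _ (f [::]) + P0 f.

Lemma lift_mor_is_additive : zmod_morphism lift_mor.
Proof.
by move=> f g; rewrite /lift_mor /P0 lift_op_is_additive fpsBE rmorphB opprD addrACA.
Qed.

Lemma lift_mor_cst c : lift_mor (fps_cst _ c) = fps_cst _ c.
Proof. by rewrite /lift_mor /P0 lift_op_cst addr0. Qed.

Lemma lift_mor_mul0 f g : f [::] = 0 -> g [::] = 0 -> P0 (f * g) = P0 f * P0 g.
Proof.
move=> f0 g0.
have fg0 : (f * g) [::] = 0 by rewrite fpsME /= f0 mul0r.
apply: fpsP => w; rewrite -(coeffs_toseq (P0 (f * g))) -(coeffs_toseq (_ * _)).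
rewrite -toseqM /P0 !toseq_lift_op // -toseqM /coeffs.
have [_ H] := hP; by rewrite (H _ _ (toseq_fun f0) (toseq_fun g0)).
Qed.

Lemma lift_mor_mul : {morph lift_mor : f g / f * g}.
Proof.
move=> f g; rewrite /lift_mor {2}split_mul /P0 !lift_opD lift_op_cst addr0 -/P0.
rewrite (lift_mor_mul0 (noconst_nil f) (noconst_nil g)) /P0 !lift_opZ !lift_op_noconst.
rewrite fpsME /= rmorphM mulrDl !mulrDr -[RHS]addrA; congr (_ + _).
by rewrite -[lift_op _ f * fps_cst _ _]fps_cstC -addrA addrCA [lift_op _ f * _ + _]addrC.
Qed.

Lemma lift_mor_deg x f : fps_deg x f -> fps_deg x (lift_mor f).
Proof.
move=> hf; apply: fps_degD; last by rewrite -[x]addr0; apply: lift_op_deg.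
by move=> [|a w] /=; [apply: hf | rewrite eqxx].
Qed.

Lemma lift_mor_van k f : fps_van k f -> fps_van k (lift_mor f).
Proof.
move=> hf; apply: fps_vanD; last exact: lift_op_van.
by move=> [|a w] // wk; apply: (hf [::] wk).
Qed.

Definition lift_fpsmor : fpsmor K (@hdeg K F) (@hdeg K E) :=
  FpsMor lift_mor_is_additive lift_mor_cst lift_mor_mul lift_mor_deg lift_mor_van.

Lemma lift_mor0 f : f [::] = 0 -> lift_mor f = P0 f.
Proof. by move=> f0; rewrite /lift_mor f0 rmorph0 add0r. Qed.

Lemma lift_mor_nil f : lift_mor f [::] = f [::].
Proof. by rewrite fpsDE [P0 f [::]]lift_op_nil addr0. Qed.

Lemma toseq_lift_mor f : f [::] = 0 -> toseq (lift_mor f) = P (toseq f).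
Proof. by move=> f0; rewrite lift_mor0 // /P0 toseq_lift_op. Qed.
End LiftMorphism.

(** * Back to the statement: inverse pullbacks and the modular function *)

Lemma toseq_inj (K : fieldType) (E : gradedSpace K) : injective (@toseq K E).
Proof.
by move=> f g e; apply: fpsP => w; rewrite -(coeffs_toseq f) e coeffs_toseq.
Qed.

Lemma lift_mor_comp (K : fieldType) (E F : gradedSpace K) P P'
    (hP : algebra_morphism (E := E) (F := F) P) (hP' : algebra_morphism P') :
  (forall f, is_function f -> forall x, P (P' f) x = f x) ->
  forall f, lift_mor hP (lift_mor hP' f) = f.
Proof.
move=> PP' f; have fE : f = noconst f + fps_cst _ (f [::]) by rewrite subrK.
have PD := raddfD (lift_fpsmor hP); have PD' := raddfD (lift_fpsmor hP').
rewrite /= in PD PD'; rewrite fE PD' PD !lift_mor_cst; congr (_ + _).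
apply: toseq_inj; have f0 := noconst_nil f.
rewrite !toseq_lift_mor ?lift_mor_nil //.
by apply: funext => x; apply: PP'; apply: toseq_fun.
Qed.

(** [Q X_a] is [(-1)^|a|] times the [a]-th coordinate of the bracket; contracting its last argument
    with the [a]-th basis vector gives a diagonal entry, with the sign of the supertrace. *)
Lemma modular_functionE (K : fieldType) (E : lieInfty K) Q (hQ : is_QE (E := E) Q) :
  @modular_function K E = toseq (vf_div (lift_vfield (proj1 hQ))).
Proof.
pose dg := @hdeg K E.
have Xn a : fps_X K dg a [::] = 0 by [].
have XE a v : toseq (fps_X K dg a) [:: v] = hcoord a v.
  transitivity (\sum_b hcoord b v * (b == a)%:R); first by [].
  rewrite (bigD1 a isT) big1 => [|b /negPf ->]; last exact: mulr0.
  by rewrite Monoid.mulm1 eq_refl mulr1.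
have Xar a : has_arity 1 (toseq (fps_X K dg a)).
  move=> x x1; apply: mext_eq0 => w wx /=; move: x1; rewrite -wx -size_rev.
  by case: (rev w) => [|b [|? ?]].
apply: funext => -[|v x].
  rewrite /toseq /= /vf_div fps_sumE big1 // => a _; rewrite fps_derE.
  (* For degree reasons [X_a] does not occur in [Q X_a], so the divergence has no constant term, in
     accordance with the value [0] at the empty sequence. *)
  have := vf_deg (lift_vfield (proj1 hQ)) (@fps_deg_X K _ dg a).
  move=> /(_ [:: a]); case: eqP => // _ /(_ isT).
  rewrite /sumz /= big_seq1 opprD opprK => /eqP.
  by rewrite -subr_eq0 opprD addrA subrr add0r opprK.
rewrite /modular_function supertraceE /vf_div.
rewrite /toseq (_ : fpsval _ \o rev = fun w => \sum_a fps_der a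
   (lift_vfield (proj1 hQ) (fps_X K dg a)) (rev w)); last first.
  by apply: funext => w /=; rewrite fps_sumE.
rewrite mext_sum; apply: eq_bigr => a _.
rewrite (_ : (fun w => _) = fun w =>
  (fpsval (lift_op (proj1 (proj1 hQ)) (fps_X K dg a)) \o rev) (rcons w a)); last first.
  by apply: funext => w; rewrite /= rev_rcons.
rewrite -mext_rcons -/(toseq _) toseq_lift_op //.
have [_ H] := hQ.
by rewrite (H _ _ (toseq_fun (Xn a)) (Xar a) (toseq_deg (@fps_deg_X K _ dg a))) //
  XE exprz_podd poddN.
Qed.

Theorem modular_class_iso (K : fieldType) (char0 : forall k, k.+1%:R != 0 :> K)
    (E F : lieInfty K) QE QF Phi P :
  is_QE QE -> is_QE QF -> lie_isomorphism (E := E) (F := F) QE QF Phi P ->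
  class_zero QE 1 (relative_modular_function P).
Proof.
move=> hE hF [[_ _ [hP _] PQ] [Psi [P' [[_ _ [hP' _] _] PP' P'P]]]].
pose VE := lift_vfield (proj1 hE); pose VF := lift_vfield (proj1 hF).
pose Ph := lift_fpsmor hP; pose Ph' := lift_fpsmor hP'.
(* Both sides kill constants, so the relation, given for functions without constant term, extends to
   all series. *)
have PhQ f : Ph (VF f) = VE (Ph f).
  have VFn : VF f [::] = 0 by apply: lift_op_nil.
  apply: toseq_inj; rewrite toseq_lift_mor //.
  rewrite /Ph /= /lift_mor /VE /VF /= lift_opD lift_op_cst add0r.
  rewrite -[lift_op _ f]lift_op_noconst -[lift_op (proj1 hP) f]lift_op_noconst.
  have f0 := noconst_nil f.
  rewrite !toseq_lift_op ?lift_op_nil //.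
  by apply: funext => x; apply: PQ; apply: toseq_fun.
have PPh f : Ph (Ph' f) = f by apply: (lift_mor_comp hP hP').
have PPh' f : Ph' (Ph f) = f by apply: (lift_mor_comp hP' hP).
have [g [g0 gdeg gE]] := vf_div_pullback char0 PhQ PPh PPh'.
exists (toseq g); split; [exact: toseq_fun | exact: toseq_deg |] => x.
(* [toseq_lift_mor] requires a series without constant term; the divergence is one because the
   modular function is [0] at the empty sequence. *)
have divn : vf_div VF [::] = 0.
  by rewrite -[LHS]/(toseq (vf_div VF) [::]) -modular_functionE.
rewrite /relative_modular_function (modular_functionE hE) (modular_functionE hF).
rewrite -(toseq_lift_mor hP divn) -(toseq_lift_op (proj1 (proj1 hE)) g0).
rewrite -[lift_op _ g]/(VE g) -gE -[lift_mor hP _]/(Ph _) -/VE -/VF.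
by rewrite toseqB.
Qed.

Theorem proposition2p6 (R : realType) (b : base_field)
    (E F : lieInfty (scalars R b))
    (QE : (seq E -> scalars R b) -> (seq E -> scalars R b))
    (QF : (seq F -> scalars R b) -> (seq F -> scalars R b))
    (Phi : seq E -> F)
    (Phistar : (seq F -> scalars R b) -> (seq E -> scalars R b)) :
  is_QE QE -> is_QE QF -> lie_isomorphism QE QF Phi Phistar ->
  class_zero QE 1 (relative_modular_function Phistar).
Proof.
apply: modular_class_iso => k.
by case: b {E F QE QF Phi Phistar} => /=; rewrite Num.Theory.pnatr_eq0.
Qed.
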